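(* There is a positive constant $\Theta$ such that, as $x\to\infty$, $$L(x;\mathrm{id})=\frac{1}{\zeta(2)}x(\log x)^2+\frac{1}{\zeta(2)}\left(2\gamma-3-\frac{\zeta'(2)}{\zeta(2)}\right)x\log x-\frac{1}{\zeta(2)}\left(4\gamma-3-2\frac{\zeta'(2)}{\zeta(2)}+\frac{\zeta'(2)}{2}-\Theta\zeta(3)-\zeta(2)\log\sqrt{2\pi}\right)x+\sum_{n\leq x}\frac{\mu(n)}{n}\Delta\!\left(\frac{x}{n}\right)\log\frac{x}{e}+O\!\left((\log x)^2\right),$$ and $$L(x;\phi)=\frac{1}{\zeta^2(2)}x(\log x)^2+\frac{1}{\zeta^2(2)}\left(2\gamma-3-2\frac{\zeta'(2)}{\zeta(2)}\right)x\log x-\frac{1}{\zeta^2(2)}\left(4\gamma-3-4\frac{\zeta'(2)}{\zeta(2)}+\frac{\zeta'(2)}{2}-\Theta\zeta(3)-\zeta(2)\log\sqrt{2\pi}\right)x+\sum_{n\leq x}\frac{(\mu*\mu)(n)}{n}\Delta\!\left(\frac{x}{n}\right)\log\frac{x}{e}+O\!\left((\log x)^3\right).$$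
   Context: For an arithmetical function $f$ and real $x>1$, $L(x;f):=\sum_{k\le x}\frac1k\sum_{j=1}^{k}f(\gcd(k,j))\log j$ (sum over positive integers $k\le x$). $\mathrm{id}(n)=n$, $\phi$ is Euler's totient function, $\mu$ the Möbius function, and $(f*g)(n)=\sum_{d\mid n}f(d)g(n/d)$ the Dirichlet convolution. $\tau(n)$ is the number of divisors of $n$, and $\Delta(x)$ is defined by $\sum_{n\le x}\tau(n)=x\log x+(2\gamma-1)x+\Delta(x)$. $\zeta$ is the Riemann zeta-function, $\gamma$ the Euler constant. *)

(* Defs.v *)
From mathcomp Require Export all_boot all_order all_algebra.
From mathcomp Require Export all_classical all_reals all_analysis.
Set Implicit Arguments.
Unset Strict Implicit.
Unset Printing Implicit Defensive.
Export Order.TTheory GRing.Theory Num.Theory.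
Export numFieldNormedType.Exports.
Global Open Scope classical_set_scope.
Global Open Scope ring_scope.

Section Defs.
Variable R : realType.

(* An arithmetical function is a map [nat -> R]; only its values at positive
   integers are ever used. *)
Implicit Types (f g : nat -> R) (x s : R) (n : nat).

Definition summatory f x : R := \sum_(1 <= n < (Num.truncn x).+1) f n.

Definition arith_id n : R := n%:R.

Definition arith_phi n : R := (totient n)%:R.

Definition arith_tau n : R := (size (divisors n))%:R.

Definition moebius n : R :=
  if (0 < n)%N && all (fun p => logn p n == 1%N) (primes n)
  then (-1) ^+ size (primes n) else 0.

Definition dirichlet f g n : R :=
  \sum_(d <- divisors n) f d * g (n %/ d)%N.

Definition gcd_log_sum f x : R :=
  summatory (fun k =>
    k%:R^-1 * \sum_(1 <= j < k.+1) f (gcdn k j) * ln j%:R) x.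

Definition euler_gamma : R :=
  limn (fun n => (\sum_(1 <= k < n.+1) k%:R^-1) - ln n%:R : R).

(* The Riemann zeta-function on the real half-line [1 < s], where it is given
   by its Dirichlet series; only values and the derivative there are used. *)
Definition zeta s : R := limn (series (fun n => (n.+1%:R `^ s)^-1 : R)).

Definition dzeta s : R := derive1 zeta s.

Definition divisor_Delta x : R :=
  summatory arith_tau x - (x * ln x + (2 * euler_gamma - 1) * x).

Definition bigO_pinfty (f g : R -> R) : Prop :=
  exists C : R, \forall x \near +oo, `|f x| <= C * `|g x|.

End Defs.

Arguments euler_gamma {R}.
Arguments zeta {R} s.
Arguments dzeta {R} s.

(* Main.v *)
From mathcomp Require Import ring lra zify cyclic.
Require Import Defs.
Set Implicit Arguments.
Unset Strict Implicit.
Unset Printing Implicit Defensive.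

(* Write [g = f * id * 1], with [f] the convolution power [mu ^ r] of the Moebius
   function: [r = 1] for [g = id] and [r = 2] for [g = phi].  Summing over the
   common divisors of [k] and [j] gives
     L(x; g) = sum_(n <= x) f(n)/n (ln (x/e) D(x/n) - P(x/n))
               + sum_(n <= x) (f * w)(n)/n floor(x/n),
   where [D] is the summatory function of [tau],
   [P y = sum_(m <= y) tau(m) ln (y/m)] and [w l = ln l! - l ln l + l].
   The hyperbola method gives [P y = y ln y + (2 gamma - 2) y + O(1 + ln y)]:
   unlike [D], this weighted sum has only a logarithmic error.  By Stirling,
   [w = ln / 2 + ln (sqrt (2 pi)) + delta] with [0 < delta l <= 1/(4 l)], so
   [Theta = zeta(3)^-1 sum_l delta(l)/l^2].  The [ln] part of [w] is convolved
   with [mu] first: [mu * ln] is the von Mangoldt function, and the bound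
   [0 <= mu * ln <= ln] saves the factor [ln x] that is lost if [mu] is
   estimated by [1].  What remains are truncated Dirichlet series at 2, whose
   tails are [O((ln x)^k / x)]. *)

(** * Sums over divisors, multiples and hyperbolic regions *)

Section DivisorSums.
Variable V : nmodType.
Implicit Types (F : nat -> V) (G : nat -> nat -> V) (a d n M N : nat).

Lemma sum_divisors n N F : (0 < n <= N)%N ->
  \sum_(d <- divisors n) F d = \sum_(1 <= d < N.+1 | (d %| n)%N) F d.
Proof.
move=> /andP[n0 nN]; rewrite -[RHS]big_filter; apply: perm_big.
apply: uniq_perm => [||d]; [exact: divisors_uniq|exact: filter_uniq (iota_uniq _ _)|].
rewrite -dvdn_divisors// mem_filter mem_index_iota.
case dn: (d %| n)%N => //=; rewrite ltnS (dvdn_gt0 n0 dn)/=.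
by rewrite (leq_trans _ nN)// dvdn_leq.
Qed.

Lemma sum_multiples d N F : (0 < d)%N ->
  \sum_(1 <= k < N.+1 | (d %| k)%N) F k =
  \sum_(1 <= m < (N %/ d).+1) F (d * m)%N.
Proof.
move=> d0; elim: N => [|N IH]; first by rewrite div0n !big_nil.
rewrite big_mkcond big_nat_recr//= -big_mkcond IH divnS//.
case: ifP => dN; last by rewrite add0n addr0.
rewrite add1n [RHS]big_nat_recr//=; congr (_ + F _).
by move: (divnS N d0); rewrite dN add1n => <-; rewrite mulnC divnK.
Qed.

Lemma sum_le_divn a M N F : (0 < a)%N -> (M %/ a <= N)%N ->
  \sum_(1 <= b < (M %/ a).+1) F b = \sum_(1 <= b < N.+1 | (a * b <= M)%N) F b.
Proof.
move=> a0 MN; rewrite (big_nat_widen _ _ N.+1)//; apply: eq_bigl => b.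
by rewrite ltnS leq_divRL// mulnC.
Qed.

Lemma exchange_sum_le_divn M G :
  \sum_(1 <= a < M.+1) \sum_(1 <= b < (M %/ a).+1) G a b =
  \sum_(1 <= b < M.+1) \sum_(1 <= a < (M %/ b).+1) G a b.
Proof.
transitivity (\sum_(1 <= a < M.+1) \sum_(1 <= b < M.+1 | (a * b <= M)%N) G a b).
  by apply: eq_big_nat => a /andP[a0 _]; rewrite (sum_le_divn _ a0 (leq_div _ _)).
rewrite (exchange_big_dep predT)//=; apply: eq_big_nat => b /andP[b0 _].
rewrite (sum_le_divn _ b0 (leq_div _ _)).
by apply: eq_bigl => a; rewrite mulnC.
Qed.

End DivisorSums.

Lemma hyperbola_sum (V : zmodType) A B M (G : nat -> nat -> V) :
  (0 < B)%N -> (A * B <= M < A.+1 * B.+1)%N ->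
  \sum_(1 <= a < M.+1) \sum_(1 <= b < (M %/ a).+1) G a b =
  \sum_(1 <= a < A.+1) \sum_(1 <= b < (M %/ a).+1) G a b
  + \sum_(1 <= b < B.+1) \sum_(1 <= a < (M %/ b).+1) G a b
  - \sum_(1 <= a < A.+1) \sum_(1 <= b < B.+1) G a b.
Proof.
move=> B0 /andP[ABM MAB].
have AM : (A <= M)%N by rewrite (leq_trans _ ABM)// leq_pmulr.
rewrite (@big_cat_nat _ _ _ A.+1)//= -addrA; congr (_ + _).
have inner_cut b : (0 < b < B.+1)%N -> \sum_(1 <= a < (M %/ b).+1) G a b =
    \sum_(1 <= a < A.+1) G a b + \sum_(A.+1 <= a < M.+1 | (a * b <= M)%N) G a b.
  move=> /andP[b0 bB]; rewrite (sum_le_divn _ b0 (leq_div _ _)).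
  rewrite (@big_cat_nat _ _ _ A.+1)//=; congr (_ + _).
    rewrite big_nat_cond [RHS]big_nat_cond; apply: eq_bigl => a.
    by rewrite andbT; case: (boolP (0 < a < A.+1)%N) => //= /andP[_ aA]; nia.
  by apply: eq_bigl => a; rewrite mulnC.
rewrite [X in _ = X - _](eq_big_nat _ _ inner_cut) big_split/=.
rewrite [X in _ - X]exchange_big/= addrAC subrr add0r.
rewrite [RHS](exchange_big_dep predT)//=; apply: eq_big_nat => a /andP[Aa _].
rewrite (@sum_le_divn _ a M B)//; last by rewrite -ltnS ltn_divLR; nia.
by rewrite (leq_trans _ Aa).
Qed.

(** * Dirichlet convolution *)

Section DirichletConvolution.
Variable R : realType.
Implicit Types (f u v w h F : nat -> R) (n N q : nat).

Definition dirichlet_unit n : R := (n == 1%N)%:R.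

Definition arith_one n : R := 1.

(* The exponent is shifted: this is the [q.+1]-fold convolution power of [f]. *)
Definition dirichlet_pow f q : nat -> R := iter q (dirichlet f) f.

Lemma sum_dirichlet N u v F :
  \sum_(1 <= k < N.+1) dirichlet u v k * F k =
  \sum_(1 <= n < N.+1) u n * \sum_(1 <= m < (N %/ n).+1) v m * F (n * m)%N.
Proof.
transitivity (\sum_(1 <= k < N.+1) \sum_(1 <= d < N.+1 | (d %| k)%N)
    u d * v (k %/ d)%N * F k).
  by apply: eq_big_nat => k kN; rewrite -(@sum_divisors _ k)// -mulr_suml.
rewrite (exchange_big_dep predT)//=; apply: eq_big_nat => d /andP[d0 _].
rewrite sum_multiples// mulr_sumr; apply: eq_bigr => m _.
by rewrite mulKn// mulrA.
Qed.

Lemma eq_of_weighted_sums n u v : (0 < n)%N ->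
  (forall F, \sum_(1 <= k < n.+1) u k * F k = \sum_(1 <= k < n.+1) v k * F k) ->
  u n = v n.
Proof.
move=> n0 /(_ (fun k => (k == n)%:R)).
rewrite !big_nat_recr//= eqxx !mulr1 !big1_seq ?add0r//;
by move=> k; rewrite /= mem_index_iota => /andP[_ kn]; rewrite ltn_eqF ?mulr0.
Qed.

Lemma dirichletC u v n : (0 < n)%N -> dirichlet u v n = dirichlet v u n.
Proof.
move=> n0; apply: eq_of_weighted_sums => // F; rewrite !sum_dirichlet.
under eq_bigr do rewrite mulr_sumr.
rewrite exchange_sum_le_divn; apply: eq_bigr => m _; rewrite mulr_sumr.
by apply: eq_bigr => k _; rewrite mulnC mulrCA.
Qed.

Lemma dirichletA u v w n : (0 < n)%N ->
  dirichlet u (dirichlet v w) n = dirichlet (dirichlet u v) w n.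
Proof.
move=> n0; apply: eq_of_weighted_sums => // F; rewrite !sum_dirichlet.
apply: eq_bigr => a _; congr (_ * _); rewrite sum_dirichlet.
apply: eq_bigr => b _; congr (_ * _); rewrite divnMA.
by apply: eq_bigr => c _; rewrite mulnA.
Qed.

Lemma eq_dirichlet u1 u2 v1 v2 n : (0 < n)%N ->
  (forall k, (0 < k)%N -> u1 k = u2 k) -> (forall k, (0 < k)%N -> v1 k = v2 k) ->
  dirichlet u1 v1 n = dirichlet u2 v2 n.
Proof.
move=> n0 u12 v12; rewrite /dirichlet !big_seq; apply: eq_bigr => d.
rewrite -dvdn_divisors// => dn; have d0 := dvdn_gt0 n0 dn.
by rewrite u12// v12// divn_gt0// dvdn_leq.
Qed.

Lemma eq_dirichletl u1 u2 v n : (0 < n)%N -> (forall k, (0 < k)%N -> u1 k = u2 k) ->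
  dirichlet u1 v n = dirichlet u2 v n.
Proof. by move=> n0 u12; exact: eq_dirichlet. Qed.

Lemma eq_dirichletr u v1 v2 n : (0 < n)%N -> (forall k, (0 < k)%N -> v1 k = v2 k) ->
  dirichlet u v1 n = dirichlet u v2 n.
Proof. by move=> n0 v12; exact: eq_dirichlet. Qed.

Lemma dirichletDr u v w n :
  dirichlet u (fun k => v k + w k) n = dirichlet u v n + dirichlet u w n.
Proof. by rewrite /dirichlet -big_split; apply: eq_bigr => d _; rewrite mulrDr. Qed.

Lemma dirichletZr (a : R) u v n :
  dirichlet u (fun k => a * v k) n = a * dirichlet u v n.
Proof. by rewrite /dirichlet mulr_sumr; apply: eq_bigr => d _; rewrite mulrCA. Qed.

Lemma ler_norm_dirichlet u v n :
  `|dirichlet u v n| <= dirichlet (fun k => `|u k|) (fun k => `|v k|) n.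
Proof.
by apply: le_trans (ler_norm_sum _ _ _) _; under eq_bigr do rewrite normrM.
Qed.

Lemma dirichlet_unitl u n : (0 < n)%N -> dirichlet dirichlet_unit u n = u n.
Proof.
move=> n0; rewrite /dirichlet (@sum_divisors _ n n) ?n0 ?leqnn//.
rewrite big_mkcond big_ltn//= dvd1n /dirichlet_unit/= mul1r divn1.
rewrite big1_seq ?addr0// => d /=; rewrite mem_index_iota => /andP[d1 _].
by rewrite gtn_eqF// mul0r if_same.
Qed.

Lemma dirichlet_additiveM u v h n :
  (forall a b, (0 < a)%N -> (0 < b)%N -> h (a * b)%N = h a + h b) -> (0 < n)%N ->
  dirichlet u v n * h n =
  dirichlet (fun k => u k * h k) v n + dirichlet u (fun k => v k * h k) n.
Proof.
move=> hM n0; rewrite /dirichlet mulr_suml -big_split/= !big_seq.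
apply: eq_bigr => d; rewrite -dvdn_divisors// => dn; have d0 := dvdn_gt0 n0 dn.
rewrite -{2}(divnK dn) mulnC hM ?divn_gt0//; last exact: dvdn_leq.
ring.
Qed.

Lemma dirichlet_one_one n : dirichlet arith_one arith_one n = arith_tau R n.
Proof.
by rewrite /dirichlet /arith_one mulr1 big_const_seq count_predT iter_addr_0.
Qed.

Lemma dirichlet_id_id n : (0 < n)%N ->
  dirichlet (arith_id R) (arith_id R) n = n%:R * arith_tau R n.
Proof.
move=> n0; rewrite -dirichlet_one_one /dirichlet mulr_sumr !big_seq.
apply: eq_bigr => d; rewrite -dvdn_divisors// => dn.
by rewrite !mulr1 -natrM mulnC divnK.
Qed.

Lemma dirichlet_phi_one n : (0 < n)%N ->
  dirichlet (arith_phi R) arith_one n = arith_id R n.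
Proof.
move=> n0; rewrite /dirichlet (@sum_divisors _ n n) ?n0 ?leqnn// /arith_id.
rewrite -[in RHS](sum_totient_dvd n) natr_sum
  -(big_mkord (fun d => d %| n)%N (fun d => (totient d)%:R)).
rewrite [RHS]big_mkcond [RHS]big_ltn//= dvd0n eqn0Ngt n0/= add0r -big_mkcond.
by apply: eq_bigr => d _; rewrite mulr1.
Qed.

Lemma cesaro_sum_gcdn f h n : (0 < n)%N ->
  \sum_(1 <= j < n.+1) dirichlet f arith_one (gcdn n j) * h j =
  \sum_(d <- divisors n) f d * \sum_(1 <= m < (n %/ d).+1) h (d * m)%N.
Proof.
move=> n0; transitivity (\sum_(1 <= j < n.+1)
    \sum_(1 <= d < n.+1 | (d %| n)%N && (d %| j)%N) f d * h j).
  apply: eq_big_nat => j /andP[j0 _].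
  have gn : (0 < gcdn n j <= n)%N by rewrite gcdn_gt0 n0/= dvdn_leq// dvdn_gcdl.
  rewrite /dirichlet (@sum_divisors _ _ n)// mulr_suml.
  by apply: eq_big => d; [rewrite dvdn_gcd|rewrite mulr1].
rewrite (exchange_big_dep (fun d => d %| n)%N)//=; last first.
  by move=> j d _ /andP[].
rewrite (@sum_divisors _ n n) ?n0 ?leqnn// big_nat_cond [RHS]big_nat_cond.
apply: eq_bigr => d /andP[/andP[d0 _] dn].
by rewrite dn/= sum_multiples// mulr_sumr.
Qed.

End DirichletConvolution.

Arguments dirichlet_unit {R} n.
Arguments arith_one {R} n.

(** * The Moebius and von Mangoldt functions *)

Section MoebiusVonMangoldt.
Variable R : realType.
Implicit Types (u F : nat -> R) (k m n p : nat).
Local Notation mu := (moebius R).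

Lemma moebius_not_squarefree p n : prime p -> (1 < logn p n)%N -> mu n = 0.
Proof.
move=> pp pn; rewrite /moebius; case: ifP => // /andP[n0 /allP/(_ p)].
rewrite -logn_gt0 (ltn_trans _ pn)// => /(_ isT)/eqP pn1.
by rewrite pn1 in pn.
Qed.

Lemma moebius_primeM p n : prime p -> (0 < n)%N -> ~~ (p %| n)%N ->
  mu (p * n) = - mu n.
Proof.
move=> pp n0 pn; have p0 := prime_gt0 pp.
have prm : perm_eq (primes (p * n)) (p :: primes n).
  apply: uniq_perm; first exact: primes_uniq.
    by rewrite /= primes_uniq mem_primes pp n0 (negbTE pn).
  by move=> q; rewrite primesM// primes_prime// !inE.
rewrite /moebius muln_gt0 p0 n0/= (perm_size prm) (perm_all _ prm)/=.
rewrite lognM// logn_prime// eqxx (_ : logn p n = 0)%N/=; last first.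
  by apply/eqP; rewrite -leqn0 leqNgt logn_gt0 mem_primes pp n0.
rewrite (_ : all _ (primes n) = all (fun q => logn q n == 1%N) (primes n)).
  by case: ifP => _; rewrite ?oppr0// exprS mulN1r.
apply: eq_in_all => q; rewrite mem_primes => /and3P[pq _ qn].
rewrite lognM// logn_prime//; case: (eqVneq q p) => [qp|_]//=.
by move: qn; rewrite qp (negbTE pn).
Qed.

Lemma norm_moebius_le1 n : `|mu n| <= 1.
Proof.
rewrite /moebius; case: ifP => _; last by rewrite normr0.
by rewrite normrX normrN1 expr1n.
Qed.

Lemma sum_moebius_pfactor p m k F : prime p -> (0 < m)%N -> ~~ (p %| m)%N ->
  \sum_(d <- divisors (m * p ^ k.+1)) mu d * F d =
  \sum_(d <- divisors m) mu d * (F d - F (p * d)%N).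
Proof.
move=> pp m0 pm; set n := (m * p ^ k.+1)%N; have p0 := prime_gt0 pp.
have n0 : (0 < n)%N by rewrite muln_gt0 m0 expn_gt0 p0.
have dvdn_m d : ~~ (p %| d)%N -> (d %| n)%N = (d %| m)%N.
  by move=> pd; rewrite Gauss_dvdl// coprimeXr// coprime_sym prime_coprime.
have dvdm_Np d : (d %| m)%N -> ~~ (p %| d)%N.
  by move=> dm; apply: contra pm => /dvdn_trans; apply.
have mnp : (m <= n %/ p)%N.
  by rewrite leq_divRL// leq_mul// expnS leq_pmulr// expn_gt0 p0.
under [RHS]eq_bigr do rewrite mulrBr.
rewrite sumrB (@sum_divisors _ n n) ?n0 ?leqnn//.
rewrite (bigID (fun d => (p %| d)%N))/= addrC; congr (_ + _).
  rewrite (@sum_divisors _ m n) ?m0 ?(leq_trans mnp) ?leq_div//; apply: eq_bigl => d.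
  case pd: (p %| d)%N; first by rewrite andbF; apply/esym/negP => /dvdm_Np; rewrite pd.
  by rewrite andbT dvdn_m// pd.
rewrite big_mkcondl sum_multiples// (@sum_divisors _ m (n %/ p)) ?m0//.
rewrite -sumrN [RHS]big_mkcond; apply: eq_big_nat => e /andP[e0 _].
case: ifP => [en|/negP en]; case: ifP => em //.
- by rewrite moebius_primeM ?mulNr// dvdm_Np.
- case pe: (p %| e)%N; last first.
    by move: em; rewrite -dvdn_m ?pe// (dvdn_trans _ en)// dvdn_mull.
  rewrite (@moebius_not_squarefree p) ?mul0r// lognM// logn_prime// eqxx.
  by rewrite add1n ltnS logn_gt0 mem_primes pp e0.
- by case: en; rewrite /n mulnC dvdn_mul// expnS dvdn_mulr.
Qed.

Lemma prime_power_factor n : (1 < n)%N -> exists p m k,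
  [/\ prime p, (0 < m)%N, ~~ (p %| m)%N & n = (m * p ^ k.+1)%N].
Proof.
move=> n1; have n0 := ltnW n1; have pp := pdiv_prime n1.
have [m pm nE] := pfactor_coprime pp n0.
have : (0 < logn (pdiv n) n)%N by rewrite logn_gt0 mem_primes pp n0 pdiv_dvd.
case ek: (logn _ _) => [//|k] _; exists (pdiv n), m, k; split => //.
- by move: n0; rewrite {1}nE muln_gt0 => /andP[].
- by rewrite -prime_coprime.
- by rewrite -ek.
Qed.

Lemma dirichlet_moebius_one n : (0 < n)%N ->
  dirichlet mu arith_one n = dirichlet_unit n.
Proof.
rewrite leq_eqVlt => /predU1P[<-|n1].
  by rewrite /dirichlet /dirichlet_unit/= big_seq1 mulr1.
rewrite /dirichlet /dirichlet_unit gtn_eqF//.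
have [p [m [k [pp m0 pm ->]]]] := prime_power_factor n1.
by rewrite (@sum_moebius_pfactor _ _ _ arith_one) ?big1// => d _; rewrite subrr mulr0.
Qed.

Lemma dirichlet_moebiusK u n : (0 < n)%N ->
  dirichlet mu (dirichlet arith_one u) n = u n.
Proof.
move=> n0; rewrite dirichletA// -[RHS]dirichlet_unitl//.
exact: eq_dirichletl dirichlet_moebius_one.
Qed.

Lemma dirichlet_oneK u n : (0 < n)%N ->
  dirichlet arith_one (dirichlet mu u) n = u n.
Proof.
move=> n0; rewrite -[RHS](dirichlet_moebiusK u n0) !dirichletA//.
by apply: eq_dirichletl => // k k0; rewrite dirichletC.
Qed.

Lemma arith_id_moebius n : (0 < n)%N ->
  arith_id R n = dirichlet (dirichlet mu (arith_id R)) arith_one n.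
Proof. by move=> n0; rewrite dirichletC// dirichlet_oneK. Qed.

Lemma arith_phi_moebius n : (0 < n)%N ->
  arith_phi R n = dirichlet (dirichlet (dirichlet mu mu) (arith_id R)) arith_one n.
Proof.
move=> n0; rewrite -dirichletA// -dirichletA//.
rewrite -[LHS]dirichlet_moebiusK//; apply: eq_dirichletr => // k k0.
rewrite dirichletA// -arith_id_moebius// dirichletC//; exact: dirichlet_phi_one.
Qed.

Definition arith_ln n : R := ln n%:R.

Definition von_mangoldt : nat -> R := dirichlet mu arith_ln.

Lemma arith_ln_ge0 n : 0 <= arith_ln n.
Proof. by case: n => [|n]; [rewrite /arith_ln ln0|rewrite ln_ge0// ler1n]. Qed.

Lemma arith_lnM m n : (0 < m)%N -> (0 < n)%N ->
  arith_ln (m * n) = arith_ln m + arith_ln n.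
Proof. by move=> m0 n0; rewrite /arith_ln natrM lnM// posrE ltr0n. Qed.

Lemma von_mangoldt_ge0 n : (0 < n)%N -> 0 <= von_mangoldt n.
Proof.
rewrite leq_eqVlt => /predU1P[<-|n1].
  by rewrite /von_mangoldt /dirichlet/= big_seq1 /arith_ln divn1 ln1 mulr0.
have n0 := ltnW n1; have [p [m [k [pp m0 pm nE]]]] := prime_power_factor n1.
have -> : von_mangoldt n = \sum_(d <- divisors n) mu d * (arith_ln n - arith_ln d).
  rewrite /von_mangoldt /dirichlet !big_seq; apply: eq_bigr => d.
  rewrite -dvdn_divisors// => dn; have d0 := dvdn_gt0 n0 dn; congr (_ * _).
  by rewrite -[in arith_ln n](divnK dn) arith_lnM ?addrK// divn_gt0// dvdn_leq.
rewrite [in divisors n]nE.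
rewrite (@sum_moebius_pfactor _ _ _ (fun d => arith_ln n - arith_ln d))//.
rewrite big_seq (eq_bigr (fun d => arith_ln p * (mu d * arith_one (m %/ d)))).
  rewrite -mulr_sumr -big_seq mulr_ge0 ?arith_ln_ge0//.
  by have := dirichlet_moebius_one m0; rewrite /dirichlet => ->; rewrite ler0n.
move=> d; rewrite -dvdn_divisors// => dm.
by rewrite arith_lnM ?(prime_gt0 pp) ?(dvdn_gt0 m0 dm)// /arith_one; ring.
Qed.

Lemma dirichlet_one_von_mangoldt n : (0 < n)%N ->
  dirichlet arith_one von_mangoldt n = arith_ln n.
Proof. exact: dirichlet_oneK. Qed.

Lemma von_mangoldt_le n : (0 < n)%N -> von_mangoldt n <= arith_ln n.
Proof.
move=> n0; rewrite -(dirichlet_one_von_mangoldt n0) dirichletC// /dirichlet.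
rewrite (@sum_divisors _ n n) ?n0 ?leqnn// big_mkcond big_nat_recr//= dvdnn mulr1 lerDr.
rewrite big_nat; apply: sumr_ge0 => d /andP[d0 _]; case: ifP => // _.
by rewrite mulr1 von_mangoldt_ge0.
Qed.

End MoebiusVonMangoldt.

(** * Summatory functions *)

Section Summatory.
Variable R : realType.
Implicit Types (f g u v F : nat -> R) (x : R) (n : nat).

Lemma ler_nat_truncn n x : (0 < n <= Num.truncn x)%N -> n%:R <= x.
Proof.
move=> /andP[n0 nx]; have x1 : 1 <= x by rewrite -truncn_gt0 (leq_trans n0).
by rewrite -truncn_ge_nat// (le_trans _ x1).
Qed.

Lemma eq_summatory f g x : (forall n, (0 < n)%N -> n%:R <= x -> f n = g n) ->
  summatory f x = summatory g x.
Proof.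
by move=> fg; apply: eq_big_nat => n /andP[n0 nx]; rewrite fg// ler_nat_truncn ?n0.
Qed.

Lemma ler_summatory f g x : (forall n, (0 < n)%N -> n%:R <= x -> f n <= g n) ->
  summatory f x <= summatory g x.
Proof.
by move=> fg; apply: ler_sum_nat => n /andP[n0 nx]; rewrite fg// ler_nat_truncn ?n0.
Qed.

Lemma ler_norm_summatory f x : `|summatory f x| <= summatory (fun n => `|f n|) x.
Proof. exact: ler_norm_sum. Qed.

Lemma summatoryD f g x :
  summatory (fun n => f n + g n) x = summatory f x + summatory g x.
Proof. exact: big_split. Qed.

Lemma summatoryB f g x :
  summatory (fun n => f n - g n) x = summatory f x - summatory g x.
Proof. by rewrite /summatory sumrB. Qed.

Lemma summatoryZl a f x : summatory (fun n => a * f n) x = a * summatory f x.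
Proof. by rewrite /summatory mulr_sumr. Qed.

Lemma summatoryZr a f x : summatory (fun n => f n * a) x = summatory f x * a.
Proof. by rewrite /summatory mulr_suml. Qed.

Lemma summatory_cst a x : summatory (fun=> a) x = (Num.truncn x)%:R * a.
Proof. by rewrite /summatory sumr_const_nat subn1 mulr_natl. Qed.

Lemma summatory_nat f n : summatory f n%:R = \sum_(1 <= k < n.+1) f k.
Proof. by rewrite /summatory natrK. Qed.

Lemma truncn_divn x n : 0 <= x -> (0 < n)%N ->
  Num.truncn (x / n%:R) = (Num.truncn x %/ n)%N.
Proof.
move=> x0 n0; have n0' : 0 < n%:R :> R by rewrite ltr0n.
apply: truncn_def; rewrite ler_pdivlMr// ltr_pdivrMr// -!natrM.
by rewrite -truncn_ge_nat// leq_divM/= -truncn_lt_nat// ltn_ceil.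
Qed.

Lemma summatory_dirichlet u v F x : 0 <= x ->
  summatory (fun k => dirichlet u v k * F k) x =
  summatory (fun n => u n * summatory (fun m => v m * F (n * m)%N) (x / n%:R)) x.
Proof.
move=> x0; rewrite /summatory sum_dirichlet; apply: eq_big_nat => n /andP[n0 _].
by rewrite truncn_divn.
Qed.

Lemma ge1_div_nat x n : (0 < n)%N -> n%:R <= x -> 1 <= x / n%:R <= x.
Proof.
move=> n0 nx; have n0' : 0 < n%:R :> R by rewrite ltr0n.
rewrite ler_pdivlMr// mul1r nx/= ler_pdivrMr// ler_peMr ?ler1n//.
by rewrite (le_trans _ nx).
Qed.

Lemma truncn_ge1_bounds x : 1 <= x -> let N := Num.truncn x in
  [/\ (0 < N)%N, N%:R <= x, x < N%:R + 1 & x <= 2 * N%:R].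
Proof.
move=> x1 N; have N0 : (0 < N)%N by rewrite truncn_gt0.
have /andP[Nx xN] : N%:R <= x < N.+1%:R by apply: truncn_itv; rewrite (le_trans _ x1).
rewrite natr1; split => //; have : (1 : R) <= N%:R by rewrite ler1n.
by move: xN; rewrite -natr1; lra.
Qed.

End Summatory.

(** * Elementary estimates for logarithms and limits *)

Section LogarithmEstimates.
Variable R : realType.
Implicit Types (f df : R -> R) (u v : nat -> R) (a b e x y z : R) (k n : nat).

Definition log1 x : R := 1 + ln x.

Lemma log1_ge1 x : 1 <= x -> 1 <= log1 x.
Proof. by move=> x1; rewrite lerDl ln_ge0. Qed.

Lemma log1_ge0 x : 1 <= x -> 0 <= log1 x.
Proof. by move=> /log1_ge1; exact: le_trans. Qed.

Lemma le_log1 x y : 0 < x -> x <= y -> log1 x <= log1 y.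
Proof.
by move=> x0 xy; rewrite lerD2l ler_ln ?posrE// (lt_le_trans x0).
Qed.

Lemma le_log1X k x y : 1 <= x -> x <= y -> log1 x ^+ k <= log1 y ^+ k.
Proof.
move=> x1 xy; have x0 : 0 < x by apply: lt_le_trans x1.
by rewrite lerXn2r ?nnegrE ?log1_ge0 ?(le_trans x1)// le_log1.
Qed.

Lemma log1_le_powR e x : 0 < e -> 1 <= x -> log1 x <= (1 + e^-1) * x `^ e.
Proof.
move=> e0 x1; have x0 : x != 0 by rewrite gt_eqF// (lt_le_trans _ x1).
apply: (@le_trans _ _ ((1 + e^-1) * (1 + e * ln x))); last first.
  rewrite ler_wpM2l ?addr_ge0 ?invr_ge0 ?(ltW e0)//.
  by rewrite /powR (negbTE x0) expR_ge1Dx.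
have -> : (1 + e^-1) * (1 + e * ln x) = log1 x + (e^-1 + e * ln x).
  by rewrite /log1; field; rewrite gt_eqF.
by rewrite lerDl addr_ge0 ?invr_ge0 ?mulr_ge0 ?ln_ge0 ?(ltW e0).
Qed.

Lemma ln_nat_succ_ge n : (0 < n)%N -> n.+1%:R^-1 <= ln n.+1%:R - ln n%:R :> R.
Proof.
move=> n0; have n0' : 0 < n%:R :> R by rewrite ltr0n.
rewrite -lerN2 opprB -ln_div ?posrE ?ltr0n//.
have -> : n%:R / n.+1%:R = 1 + - n.+1%:R^-1 :> R.
  by rewrite -natr1; field; rewrite gt_eqF// ltr_wpDr.
by apply: le_ln1Dx; rewrite ltrN2 invf_lt1 ?ltr0n// ltr1n ltnS.
Qed.

Lemma ln_nat_succ_le n : (0 < n)%N -> ln n.+1%:R - ln n%:R <= n%:R^-1 :> R.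
Proof.
move=> n0; have n0' : 0 < n%:R :> R by rewrite ltr0n.
rewrite -ln_div ?posrE ?ltr0n// -natr1 mulrDl divff ?gt_eqF// mul1r le_ln1Dx//.
by rewrite (lt_trans (ltrN10 _)) ?invr_gt0.
Qed.

Lemma is_derive_MVT f df a b : a < b ->
  (forall x, a <= x <= b -> is_derive x 1 f (df x)) ->
  exists2 c, a < c < b & f b - f a = df c * (b - a).
Proof.
move=> ab fdf; have [x||c] := @MVT R f df a b ab.
- by rewrite in_itv/= => /andP[ax xb]; apply: fdf; rewrite !ltW.
- apply: continuous_in_subspaceT => x; rewrite inE/= in_itv/= => /fdf fx.
  by apply/differentiable_continuous/derivable1_diffP; exact: ex_derive.
- by rewrite in_itv/= => cab fE; exists c.
Qed.

Lemma ln_gt_pade y : 1 < y -> 2 * (y - 1) / (y + 1) < ln y.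
Proof.
move=> y1; pose f z := ln z + 4 * (z + 1)^-1.
have [z /andP[z1 _]|c /andP[c1 _] fE] :=
    @is_derive_MVT f (fun z => z^-1 - 4 * (z + 1) ^- 2) 1 y y1.
  have z0 : 0 < z by apply: lt_le_trans z1.
  have zn : z + 1 != 0 by rewrite gt_eqF// addr_gt0.
  have dln := is_derive1_ln z0; apply: is_derive_eq.
  by rewrite addr0 /GRing.scale/=; field; rewrite zn gt_eqF.
have c0 : 0 < c by apply: lt_trans c1.
have f_gt : 0 < f y - f 1.
  have -> : f y - f 1 = (c - 1) ^+ 2 / (c * (c + 1) ^+ 2) * (y - 1).
    by rewrite fE; field; rewrite !gt_eqF// addr_gt0.
  by rewrite mulr_gt0 ?divr_gt0 ?mulr_gt0 ?exprn_gt0 ?subr_gt0 ?addr_gt0.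
rewrite -subr_gt0 (_ : _ - _ = f y - f 1)// /f ln1.
by field; rewrite gt_eqF//; lra.
Qed.

Lemma ln_lt_half_subV y : 1 < y -> ln y < (y - y^-1) / 2.
Proof.
move=> y1; pose f z : R := (z - z^-1) / 2 - ln z.
have [z /andP[z1 _]|c /andP[c1 _] fE] :=
    @is_derive_MVT f (fun z => (1 + z ^- 2) / 2 - z^-1) 1 y y1.
  have z0 : 0 < z by apply: lt_le_trans z1.
  have zn : z != 0 by rewrite gt_eqF.
  have dln := is_derive1_ln z0.
  have dinv : is_derive z 1 (fun t : R => t^-1) _ :=
    @is_deriveV R id z 1 1 zn (is_derive_id _ _).
  by apply: is_derive_eq; rewrite /GRing.scale/=; field.
have c0 : 0 < c by apply: lt_trans c1.
have f_gt : 0 < f y - f 1.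
  have -> : f y - f 1 = (1 - c^-1) ^+ 2 / 2 * (y - 1).
    by rewrite fE; field; rewrite gt_eqF.
  by rewrite mulr_gt0 ?divr_gt0 ?exprn_gt0 ?subr_gt0// invf_lt1.
rewrite -subr_gt0 (_ : _ - _ = f y - f 1)// /f ln1 invr1; ring.
Qed.

Lemma ln_sub_bounds x z : 0 < x -> x <= z ->
  0 <= (z - x) / x - (ln z - ln x) <= ((z - x) / x) ^+ 2 / 2.
Proof.
move=> x0 xz; pose e := (z - x) / x; have -> : ln z - ln x = ln (1 + e).
  rewrite -ln_div ?posrE ?(lt_le_trans x0)//.
  by congr ln; rewrite /e; field; rewrite gt_eqF.
rewrite -/e; have : 0 <= e by rewrite divr_ge0 ?subr_ge0// ltW.
rewrite le_eqVlt => /predU1P[<-|e0]; first by rewrite addr0 ln1; lra.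
have e1 : 1 < 1 + e by rewrite ltrDl.
rewrite subr_ge0 le_ln1Dx ?(lt_trans _ e0) ?ltrN10//= lerBlDl -lerBlDr.
apply: le_trans (ltW (ln_gt_pade e1)); rewrite ler_pdivlMr; last by lra.
have : 0 <= e ^+ 3 by rewrite exprn_ge0// ltW.
by rewrite !exprS expr0; move: e e0 {e1} => e e0; nra.
Qed.

Lemma ln_sub_unit_bounds x z : 0 < x -> x <= z -> z <= x + 1 ->
  0 <= (z - x) / x - (ln z - ln x) <= x^-1 ^+ 2 / 2.
Proof.
move=> x0 xz zx; have /andP[-> /le_trans-> //] := ln_sub_bounds x0 xz.
rewrite ler_wpM2r// lerXn2r ?nnegrE ?divr_ge0 ?invr_ge0 ?subr_ge0 ?(ltW x0)//.
by rewrite -[leRHS]mul1r ler_wpM2r ?invr_ge0 ?(ltW x0)// lerBlDl.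
Qed.

Lemma telescoping_cvg u v :
  (forall n, (0 < n)%N -> `|u n.+1 - u n| <= v n - v n.+1) ->
  (forall n, (0 < n)%N -> 0 <= v n) ->
  exists2 l : R, u @ \oo --> l & forall n, (0 < n)%N -> `|u n - l| <= v n.
Proof.
move=> uv v0; pose lo n := u n.+1 - v n.+1; pose up n := u n.+1 + v n.+1.
have lo_incr : nondecreasing_seq lo.
  by apply/nondecreasing_seqP => n; have := @uv n.+1 isT; rewrite ler_norml /lo; lra.
have up_decr : nonincreasing_seq up.
  by apply/nonincreasing_seqP => n; have := @uv n.+1 isT; rewrite ler_norml /up; lra.
have lo_le_up n : lo n <= up n by have := @v0 n.+1 isT; rewrite /lo /up; lra.
have lo_cvg : cvgn lo.
  apply: nondecreasing_is_cvgn => //; exists (up 0%N) => _ [n _ <-].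
  exact: le_trans (lo_le_up n) (up_decr _ _ _).
have up_cvg : cvgn up.
  apply: nonincreasing_is_cvgn => //; exists (lo 0%N) => _ [n _ <-].
  exact: le_trans (lo_incr _ _ _) (lo_le_up n).
exists ((limn lo + limn up) / 2) => [|[//|n] _].
  rewrite -(cvg_shiftS u) (_ : (fun n => u n.+1) = (fun n => (lo n + up n) / 2)).
    by apply: cvgMr_tmp; exact: cvgD.
  by apply/funext => n; rewrite /lo /up; field.
have := nondecreasing_cvgn_le lo_incr lo_cvg n.
have := nonincreasing_cvgn_ge up_decr up_cvg n.
have : limn lo <= limn up by apply: ler_lim => //; near=> m; exact: lo_le_up.
by rewrite ler_norml /lo /up; lra.
Unshelve. all: end_near. Qed.

Lemma cvg_div_nat x : x / n%:R @[n --> \oo] --> (0 : R).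
Proof.
rewrite -[X in _ --> X](mulr0 x); apply: cvgMl_tmp.
by rewrite -(cvg_shiftS (fun n => n%:R^-1 : R)); exact: cvg_harmonic.
Qed.

Lemma norm_le_div_nat_eq0 x a : (forall n, (0 < n)%N -> `|x| <= a / n%:R) -> x = 0.
Proof.
move=> xa; apply/eqP; rewrite -normr_le0.
apply: ler_cvg_to (cvg_cst _) (cvg_div_nat a) _.
by near=> n; apply: xa; near: n; exists 1%N.
Unshelve. all: end_near. Qed.

Lemma cvg_log1X_powRN e k : 0 < e ->
  log1 n%:R ^+ k * n%:R `^ (- e) @[n --> \oo] --> (0 : R).
Proof.
move=> e0; pose d := e / k.+1%:R; have d0 : 0 < d by rewrite divr_gt0.
pose M := (1 + d^-1) ^+ k.
have M0 : 0 <= M by rewrite exprn_ge0// addr_ge0// invr_ge0 ltW.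
apply/cvgr0Pnorm_le => r r0; near=> n.
have n1 : 1 <= n%:R :> R by rewrite ler1n; near: n; exists 1%N.
have n0 : 0 < n%:R :> R by apply: lt_le_trans n1.
have nM : (M / r) `^ d^-1 <= n%:R by near: n; exact: nbhs_infty_ger.
rewrite ger0_norm ?mulr_ge0 ?exprn_ge0 ?log1_ge0 ?powR_ge0//.
apply: (@le_trans _ _ (M * (n%:R `^ d) ^+ k * n%:R `^ (- e))).
  rewrite ler_wpM2r ?powR_ge0// /M -exprMn lerXn2r ?nnegrE ?log1_ge0 ?log1_le_powR//.
  by rewrite mulr_ge0 ?powR_ge0// addr_ge0 ?invr_ge0 ?(ltW d0).
rewrite -mulrA -powR_mulrn ?powR_ge0// -powRrM -powRD; last first.
  by rewrite (gt_eqF n0) implybT.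
have -> : d * k%:R - e = - d by rewrite /d -natr1; field; rewrite gt_eqF// ltr_wpDl.
rewrite powRN ler_pdivrMr ?powR_gt0// mulrC -ler_pdivrMr//.
have Mr0 : 0 <= M / r by rewrite divr_ge0// ltW.
have -> : M / r = ((M / r) `^ d^-1) `^ d.
  by rewrite -powRrM mulVf ?gt_eqF// powRr1.
by rewrite ge0_ler_powR ?nnegrE ?powR_ge0 ?(ltW d0).
Unshelve. all: end_near. Qed.

End LogarithmEstimates.

(** * Logarithmically bounded functions *)

Section LogBounded.
Variable R : realType.
Implicit Types (f : nat -> R) (g h : R -> R) (a x : R) (j k l n : nat).

(* The bound is required for all [x >= 1], not only for large [x], so that it
   can be summed over the arguments [x / n] with [n <= x]. *)
Definition log_bounded k g :=
  exists2 C : R, 0 <= C & forall x, 1 <= x -> `|g x| <= C * log1 x ^+ k.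

Lemma eq_log_bounded k g h :
  (forall x, 1 <= x -> g x = h x) -> log_bounded k g -> log_bounded k h.
Proof. by move=> gh [C C0 gC]; exists C => // x x1; rewrite -gh// gC. Qed.

Lemma log_bounded_le k g h :
  (forall x, 1 <= x -> `|h x| <= `|g x|) -> log_bounded k g -> log_bounded k h.
Proof.
by move=> hg [C C0 gC]; exists C => // x x1; rewrite (le_trans (hg _ x1)) ?gC.
Qed.

Lemma log_boundedW k l g : (k <= l)%N -> log_bounded k g -> log_bounded l g.
Proof.
move=> kl [C C0 gC]; exists C => // x x1; apply: le_trans (gC x x1) _.
by rewrite ler_wpM2l// ler_weXn2l ?log1_ge1.
Qed.

Lemma log_boundedD k g h :
  log_bounded k g -> log_bounded k h -> log_bounded k (fun x => g x + h x).
Proof.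
move=> [C C0 gC] [D D0 hD]; exists (C + D); first exact: addr_ge0.
by move=> x x1; rewrite (le_trans (ler_normD _ _))// mulrDl lerD ?gC ?hD.
Qed.

Lemma log_boundedM k l g h :
  log_bounded k g -> log_bounded l h -> log_bounded (k + l) (fun x => g x * h x).
Proof.
move=> [C C0 gC] [D D0 hD]; exists (C * D); first exact: mulr_ge0.
by move=> x x1; rewrite normrM exprD mulrACA ler_pM ?gC ?hD.
Qed.

Lemma log_bounded_cst a : log_bounded 0 (fun=> a).
Proof. by exists `|a| => // x _; rewrite expr0 mulr1. Qed.

Lemma log_boundedZ k a g : log_bounded k g -> log_bounded k (fun x => a * g x).
Proof. exact: log_boundedM (log_bounded_cst a). Qed.

Lemma log_boundedB k g h :
  log_bounded k g -> log_bounded k h -> log_bounded k (fun x => g x - h x).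
Proof.
move=> gk /(log_boundedZ (-1)) hk; apply: eq_log_bounded (log_boundedD gk hk) => x _.
by rewrite mulN1r.
Qed.

Lemma log_bounded_ln : log_bounded 1 (@ln R).
Proof. by exists 1 => // x x1; rewrite mul1r ger0_norm ?ln_ge0// lerDr. Qed.

Lemma log_bounded_bigO_pinfty k g : log_bounded k g ->
  bigO_pinfty g (fun x => ln x ^+ k).
Proof.
move=> [C C0 gC]; exists (C * 2 ^+ k); near=> x.
have ex : expR 1 <= x by near: x; apply: nbhs_pinfty_ge; exact: num_real.
have x1 : 1 <= x by apply: le_trans ex; rewrite -expR0 ler_expR.
have l1 : 1 <= ln x.
  by rewrite -(expRK 1) ler_ln ?posrE ?expR_gt0// (lt_le_trans _ x1).
apply: le_trans (gC x x1) _; rewrite -mulrA ler_wpM2l// normrX -exprMn.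
by rewrite ger0_norm ?lerXn2r ?nnegrE ?log1_ge0 /log1//; lra.
Unshelve. all: end_near. Qed.

Definition harmonic_bound j f := log_bounded j (summatory (fun n => `|f n| / n%:R)).

Lemma summatory_norm_div_ge0 f x : 0 <= summatory (fun n => `|f n| / n%:R) x.
Proof. by apply: sumr_ge0 => n _; rewrite divr_ge0. Qed.

Lemma harmonic_bound_le j f1 f2 : (forall n, (0 < n)%N -> `|f2 n| <= `|f1 n|) ->
  harmonic_bound j f1 -> harmonic_bound j f2.
Proof.
move=> f12; apply: log_bounded_le => x _.
rewrite !ger0_norm ?summatory_norm_div_ge0//.
by apply: ler_summatory => n n0 _; rewrite ler_wpM2r ?invr_ge0 ?f12.
Qed.

Lemma harmonic_boundD j f1 f2 : harmonic_bound j f1 -> harmonic_bound j f2 ->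
  harmonic_bound j (fun n => f1 n + f2 n).
Proof.
move=> b1 b2; apply: (@harmonic_bound_le _ (fun n => `|f1 n| + `|f2 n|)).
  by move=> n _; rewrite [leRHS]ger0_norm ?addr_ge0// ler_normD.
apply: eq_log_bounded (log_boundedD b1 b2) => x _; rewrite -summatoryD.
by apply: eq_summatory => n _ _; rewrite [in RHS]ger0_norm ?addr_ge0// mulrDl.
Qed.

Lemma harmonic_boundZ j a f : harmonic_bound j f -> harmonic_bound j (fun n => a * f n).
Proof.
move=> fj; apply: eq_log_bounded (log_boundedZ `|a| fj) => x _; rewrite -summatoryZl.
by apply: eq_summatory => n _ _; rewrite normrM mulrA.
Qed.

Lemma harmonic_bound_one : harmonic_bound 1 (@arith_one R).
Proof.
exists 1 => // x x1; rewrite mul1r expr1 ger0_norm ?summatory_norm_div_ge0//.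
have [N0 Nx _ _] := truncn_ge1_bounds x1.
apply: (@le_trans _ _ (log1 (Num.truncn x)%:R)); last by rewrite le_log1 ?ltr0n.
rewrite /summatory /arith_one normr1.
elim: (Num.truncn x) N0 => [//|N IH] _.
have [->|N0] := posnP N; first by rewrite big_nat1 divr1 log1_ge1.
rewrite big_nat_recr//= mul1r; apply: le_trans (lerD (IH N0) (lexx _)) _.
by rewrite /log1 -addrA lerD2l -lerBrDl ln_nat_succ_ge.
Qed.

Lemma harmonic_bound_bounded f a : (forall n, (0 < n)%N -> `|f n| <= a) ->
  harmonic_bound 1 f.
Proof.
move=> fa; apply: harmonic_bound_le (harmonic_boundZ a harmonic_bound_one) => n n0.
by rewrite mulr1 (le_trans (fa n n0))// ler_norm.
Qed.

Lemma harmonic_bound_lnM j f : harmonic_bound j f ->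
  harmonic_bound j.+1 (fun n => f n * arith_ln R n).
Proof.
move=> fj; rewrite -addn1.
apply: log_bounded_le (log_boundedM fj log_bounded_ln) => x x1.
rewrite [leLHS]ger0_norm ?summatory_norm_div_ge0//.
apply: le_trans (ler_norm _); rewrite -summatoryZr; apply: ler_summatory => n n0 nx.
rewrite normrM (ger0_norm (arith_ln_ge0 _ n)) mulrAC ler_wpM2l ?divr_ge0//.
by rewrite ler_ln ?posrE ?ltr0n// (lt_le_trans _ x1).
Qed.

Lemma harmonic_bound_arith_ln : harmonic_bound 2 (arith_ln R).
Proof.
apply: harmonic_bound_le (harmonic_bound_lnM harmonic_bound_one) => n _.
by rewrite mul1r.
Qed.

Lemma log_bounded_weighted_sum j k f g : harmonic_bound j f -> log_bounded k g ->
  log_bounded (j + k) (fun x => summatory (fun n => f n / n%:R * g (x / n%:R)) x).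
Proof.
move=> [C C0 fC] [D D0 gD]; exists (C * D) => [|x x1]; first exact: mulr_ge0.
apply: (@le_trans _ _ (summatory (fun n => `|f n| / n%:R * (D * log1 x ^+ k)) x)).
  apply: le_trans (ler_norm_summatory _ _) _; apply: ler_summatory => n n0 nx.
  have /andP[xn1 xnx] := ge1_div_nat n0 nx.
  rewrite !normrM normfV [`|n%:R|]ger0_norm// ler_wpM2l ?divr_ge0//.
  by rewrite (le_trans (gD _ xn1))// ler_wpM2l// le_log1X.
rewrite summatoryZr exprD mulrACA ler_wpM2r ?mulr_ge0 ?exprn_ge0 ?log1_ge0//.
exact: le_trans (ler_norm _) (fC x x1).
Qed.

Lemma harmonic_bound_dirichlet j k f1 f2 : harmonic_bound j f1 ->
  harmonic_bound k f2 -> harmonic_bound (j + k) (dirichlet f1 f2).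
Proof.
move=> b1 b2; pose v := dirichlet (fun n => `|f1 n|) (fun n => `|f2 n|).
have normv n : `|v n| = v n by rewrite ger0_norm// sumr_ge0// => d _; rewrite mulr_ge0.
apply: (@harmonic_bound_le _ v) => [n _|]; first by rewrite normv ler_norm_dirichlet.
have bf1 : harmonic_bound j (fun n => `|f1 n|).
  by apply: harmonic_bound_le b1 => n _; rewrite normr_id.
apply: eq_log_bounded (log_bounded_weighted_sum bf1 b2) => x x1.
under [RHS]eq_summatory do rewrite normv.
rewrite (summatory_dirichlet _ _ (fun n => n%:R^-1)) ?(le_trans _ x1)//.
apply: eq_summatory => n _ _; rewrite -mulrA -summatoryZl; congr (_ * _).
by apply: eq_summatory => m _ _; rewrite natrM invfM mulrCA.
Qed.

End LogBounded.

(** * Dirichlet series *)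

Section DirichletSeries.
Variable R : realType.
Implicit Types (f g : nat -> R) (F G s x : R) (j k l n : nat).

(* [F] is the value at [s] of the Dirichlet series of [f], with a remainder
   [O(x ^ (1 - s) (1 + ln x) ^ k)]. *)
Definition dseries s k f F :=
  log_bounded k (fun x => x `^ (s - 1) * (summatory (fun n => f n / n%:R `^ s) x - F)).

Lemma dseriesW s k l f F : (k <= l)%N -> dseries s k f F -> dseries s l f F.
Proof. exact: log_boundedW. Qed.

Lemma eq_dseries s k f g F : (forall n, (0 < n)%N -> f n = g n) ->
  dseries s k f F -> dseries s k g F.
Proof.
move=> fg; apply: eq_log_bounded => x _; congr (_ * (_ - _)).
by apply: eq_summatory => n n0 _; rewrite fg.
Qed.

Lemma dseriesD s k f g F G : dseries s k f F -> dseries s k g G ->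
  dseries s k (fun n => f n + g n) (F + G).
Proof.
move=> fF gG; apply: eq_log_bounded (log_boundedD fF gG) => x _.
rewrite -mulrDr addrACA -opprD -summatoryD; congr (_ * (_ - _)).
by apply: eq_summatory => n _ _; rewrite mulrDl.
Qed.

Lemma dseriesZ s k a f F : dseries s k f F -> dseries s k (fun n => a * f n) (a * F).
Proof.
move=> fF; apply: eq_log_bounded (log_boundedZ a fF) => x _.
rewrite mulrCA mulrBr -summatoryZl; congr (_ * (_ - _)).
by apply: eq_summatory => n _ _; rewrite mulrA.
Qed.

Lemma dseries0 s : dseries s 0 (fun=> 0) 0.
Proof.
exists 0 => // x x1; rewrite subr0 /summatory big1 ?mulr0 ?normr0 ?mul0r// => n _.
by rewrite mul0r.
Qed.

Lemma dseries_unit s : dseries s 0 dirichlet_unit 1.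
Proof.
exists 0 => // x x1; rewrite /summatory big_ltn ?ltnS ?truncn_gt0//.
rewrite big1_seq => [|n]; first by rewrite powR1 divr1 addr0 subrr mulr0 normr0 mul0r.
by rewrite /= mem_index_iota => /andP[n1 _]; rewrite /dirichlet_unit gtn_eqF// mul0r.
Qed.

Lemma powR_subr1_div s x n : 0 < x -> (0 < n)%N ->
  x `^ (s - 1) / n%:R `^ s = n%:R^-1 * (x / n%:R) `^ (s - 1).
Proof.
move=> x0 n0; have n0' : 0 < n%:R :> R by rewrite ltr0n.
have -> : (x / n%:R) `^ (s - 1) = x `^ (s - 1) * n%:R `^ (1 - s).
  rewrite powRM ?invr_ge0 ?ltW//; congr (_ * _).
  by rewrite -(powR_inv1 (ltW n0')) -powRrM mulN1r opprB.
rewrite mulrCA; congr (_ * _); rewrite -powRN -(powR_inv1 (ltW n0')) -powRD.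
  by congr (_ `^ _); ring.
by rewrite (gt_eqF n0') implybT.
Qed.

Lemma dseries_dirichlet s j k l f g F G : (l <= j + k)%N ->
  harmonic_bound j f -> dseries s l f F -> dseries s k g G ->
  dseries s (j + k) (dirichlet f g) (F * G).
Proof.
move=> ljk bf fF gG.
have fFG := log_boundedZ G (dseriesW ljk fF).
apply: eq_log_bounded (log_boundedD (log_bounded_weighted_sum bf gG) fFG) => x x1.
have x0 : 0 < x by apply: lt_le_trans x1.
rewrite (summatory_dirichlet _ _ (fun n => (n%:R `^ s)^-1)) ?(ltW x0)//.
rewrite (_ : summatory _ x = x `^ (s - 1) * summatory (fun n => f n / n%:R `^ s *
    (summatory (fun m => g m / m%:R `^ s) (x / n%:R) - G)) x); last first.
  rewrite -summatoryZl; apply: eq_summatory => n n0 _.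
  by rewrite mulrA [in RHS]mulrA [in RHS]mulrCA powR_subr1_div// !mulrA.
rewrite [G * (_ * _)]mulrCA -mulrDr; congr (_ * _).
rewrite mulrBr addrA [F * G]mulrC; congr (_ - _).
rewrite -summatoryZl -summatoryD; apply: eq_summatory => n n0 _.
rewrite mulrBr [G * _]mulrC subrK -mulrA; congr (_ * _); rewrite -summatoryZl.
by apply: eq_summatory => m m0 _; rewrite natrM powRM// invfM mulrCA.
Qed.

(* The shift [k * (2 / (s - 1))] makes the growth of the logarithmic factor cost at
   most half of the decay of [x ^ (1 - s)], so that the decrements of this function
   dominate the terms of the Dirichlet series of [log1 ^ k]. *)
Definition tail_majorant s k x : R :=
  (1 + k%:R * (2 / (s - 1)) + ln x) ^+ k * x `^ (1 - s).

Lemma tail_majorant_ge0 s k x : 1 < s -> 1 <= x -> 0 <= tail_majorant s k x.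
Proof.
move=> s1 x1; rewrite mulr_ge0 ?powR_ge0// exprn_ge0// addr_ge0 ?ln_ge0//.
by rewrite addr_ge0// mulr_ge0// divr_ge0// subr_ge0 ltW.
Qed.

Lemma tail_majorant_succ s k n : 1 < s -> (0 < n)%N ->
  tail_majorant s k n.+1%:R * expR ((s - 1) / 2 * (ln n.+1%:R - ln n%:R)) <=
  tail_majorant s k n%:R.
Proof.
move=> s1 n0; rewrite /tail_majorant; set a := 1 + _; set c := (s - 1) / 2.
have c0 : 0 < c by rewrite divr_gt0// subr_gt0.
have ka : k%:R <= c * a.
  have -> : c * a = c + k%:R by rewrite /c /a; field; rewrite gt_eqF// subr_gt0.
  by rewrite lerDr ltW.
have a0 : 0 < a by rewrite ltr_wpDr// mulr_ge0// divr_ge0// subr_ge0 ltW.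
have L0 : 0 <= ln n%:R :> R := arith_ln_ge0 R n.
have aL0 : 0 < a + ln n%:R by rewrite ltr_wpDr.
set d := ln n.+1%:R - ln n%:R.
have d0 : 0 <= d by apply: le_trans (ln_nat_succ_ge R n0).
rewrite /powR !gt_eqF ?ltr0n// -mulrA -expRD.
have -> : (1 - s) * ln n.+1%:R + c * d = (1 - s) * ln n%:R - c * d.
  by rewrite /d /c; field.
rewrite expRD mulrCA mulrC ler_pM2r ?expR_gt0// expRN ler_pdivrMr ?expR_gt0//.
have -> : a + ln n.+1%:R = (a + ln n%:R) * (1 + d / (a + ln n%:R)).
  by rewrite /d; field; rewrite gt_eqF.
rewrite exprMn ler_wpM2l ?exprn_ge0 ?(ltW aL0)//.
apply: (@le_trans _ _ (expR (d / (a + ln n%:R)) ^+ k)).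
  by rewrite lerXn2r ?nnegrE ?expR_ge0 ?expR_ge1Dx// addr_ge0// divr_ge0// ltW.
rewrite -expRM_natl ler_expR mulrA mulrAC ler_wpM2r// ler_pdivrMr//.
by apply: le_trans ka _; rewrite ler_pM2l// lerDl.
Qed.

Lemma tail_majorant_telescope s k n : 1 < s -> (0 < n)%N ->
  log1 n.+1%:R ^+ k / n.+1%:R `^ s <=
  2 / (s - 1) * (tail_majorant s k n%:R - tail_majorant s k n.+1%:R).
Proof.
move=> s1 n0; have c0 : 0 < (s - 1) / 2 by rewrite divr_gt0// subr_gt0.
have n1 : 1 <= n.+1%:R :> R by rewrite ler1n.
apply: (@le_trans _ _ (tail_majorant s k n.+1%:R / n.+1%:R)).
  rewrite /tail_majorant -mulrA -(powR_inv1 (ler0n _ _)) -powRD ?pnatr_eq0 ?implybT//.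
  rewrite (_ : 1 - s + -1 = - s); last by ring.
  rewrite powRN ler_wpM2r ?invr_ge0 ?powR_ge0//.
  have a1 : 0 <= k%:R * (2 / (s - 1)) by rewrite mulr_ge0// divr_ge0// subr_ge0 ltW.
  by rewrite lerXn2r ?nnegrE ?log1_ge0 ?addr_ge0 ?ln_ge0// lerD2r lerDl.
rewrite -[2 / _]invf_div ler_pdivlMl// lerBrDr.
apply: le_trans (tail_majorant_succ k s1 n0).
rewrite mulrCA -[X in _ + X]mulr1 -mulrDr ler_wpM2l ?tail_majorant_ge0//.
rewrite addrC (le_trans _ (expR_ge1Dx _))// lerD2l ler_pM2l//.
exact: ln_nat_succ_ge.
Qed.

Lemma tail_majorant_le s k : 1 < s -> exists2 K : R, 0 <= K & forall x, 1 <= x ->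
  x `^ (s - 1) * tail_majorant s k (Num.truncn x)%:R <= K * log1 x ^+ k.
Proof.
move=> s1; rewrite /tail_majorant; set a := 1 + _.
have a1 : 1 <= a by rewrite lerDl mulr_ge0// divr_ge0// subr_ge0 ltW.
move: a a1 => a a1; exists (a ^+ k * 2 `^ (s - 1)) => [|x x1].
  by rewrite mulr_ge0 ?powR_ge0// exprn_ge0// (le_trans _ a1).
have [N0 Nx _ xN] := truncn_ge1_bounds x1.
have N0' : 0 < (Num.truncn x)%:R :> R by rewrite ltr0n.
have x0 : 0 < x by apply: lt_le_trans x1.
have xs : x `^ (s - 1) * (Num.truncn x)%:R `^ (1 - s) <= 2 `^ (s - 1).
  rewrite -(opprB s) powRN ler_pdivrMr ?powR_gt0// -powRM ?(ltW N0')//.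
  by rewrite ge0_ler_powR ?nnegrE ?subr_ge0 ?mulr_ge0 ?(ltW s1) ?(ltW x0) ?(ltW N0').
have lnN : 0 <= ln (Num.truncn x)%:R :> R := arith_ln_ge0 R _.
rewrite mulrCA mulrAC.
rewrite ler_pM ?exprn_ge0 ?mulr_ge0 ?powR_ge0 ?addr_ge0 ?(le_trans _ a1)//.
rewrite -exprMn lerXn2r ?nnegrE ?addr_ge0 ?(le_trans _ a1)//.
  by rewrite mulr_ge0 ?log1_ge0// (le_trans _ a1).
apply: (@le_trans _ _ (a + ln x)); first by rewrite lerD2l ler_ln ?posrE.
by rewrite mulrDr mulr1 lerD2l ler_peMl ?ln_ge0.
Qed.

Lemma dseries_exists s k f (A : R) : 1 < s ->
  (forall n, (0 < n)%N -> `|f n| <= A * log1 n%:R ^+ k) -> exists F, dseries s k f F.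
Proof.
move=> s1 fA; have c0 : 0 < 2 / (s - 1) by rewrite divr_gt0// subr_gt0.
have A0 : 0 <= A.
  have := fA 1%N isT; rewrite /log1 ln1 addr0 expr1n mulr1.
  exact: le_trans (normr_ge0 _).
pose a N := \sum_(1 <= n < N.+1) f n / n%:R `^ s.
pose b N := A * (2 / (s - 1) * tail_majorant s k N%:R).
have ab n : (0 < n)%N -> `|a n.+1 - a n| <= b n - b n.+1.
  move=> n0; rewrite /a big_nat_recr//= addrAC subrr add0r normrM normfV.
  rewrite (ger0_norm (powR_ge0 _ _)) -mulrBr -mulrBr.
  apply: le_trans (ler_wpM2l A0 (tail_majorant_telescope k s1 n0)).
  by rewrite mulrA ler_wpM2r ?invr_ge0 ?powR_ge0 ?fA.
have b0 n : (0 < n)%N -> 0 <= b n.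
  by move=> n0; rewrite /b mulr_ge0// mulr_ge0 ?(ltW c0)// tail_majorant_ge0 ?ler1n.
have [F _ aF] := telescoping_cvg ab b0.
have [K K0 tK] := tail_majorant_le k s1.
exists F, (A * (2 / (s - 1) * K)) => [|x x1].
  by rewrite mulr_ge0// mulr_ge0// ltW.
rewrite normrM (ger0_norm (powR_ge0 _ _)).
have [N0 _ _ _] := truncn_ge1_bounds x1.
apply: le_trans (ler_wpM2l (powR_ge0 _ _) (aF _ N0)) _.
rewrite /b mulrCA -[leRHS]mulrA ler_wpM2l// mulrCA -[leRHS]mulrA.
by rewrite ler_wpM2l ?tK ?(ltW c0).
Qed.

Lemma dseries_cvg s k f F : 1 < s -> dseries s k f F ->
  \sum_(1 <= n < N.+1) f n / n%:R `^ s @[N --> \oo] --> F.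
Proof.
move=> s1 [C C0 fC]; have s0 : 0 < s - 1 by rewrite subr_gt0.
have bound_cvg0 : C * (log1 N%:R ^+ k * N%:R `^ (- (s - 1))) @[N --> \oo] --> 0.
  by rewrite -[X in _ --> X](mulr0 C); apply: cvgMl_tmp; exact: cvg_log1X_powRN.
apply/subr_cvg0; apply: norm_cvg0.
apply: (squeeze_cvgr _ (cvg_cst 0) bound_cvg0); near=> N; rewrite normr_ge0/=.
have N1 : 1 <= N%:R :> R by rewrite ler1n; near: N; exists 1%N.
have N0 : 0 < N%:R `^ (s - 1) by rewrite powR_gt0// (lt_le_trans _ N1).
rewrite powRN mulrA ler_pdivlMr// mulrC.
by have := fC _ N1; rewrite summatory_nat normrM (ger0_norm (ltW N0)).
Unshelve. all: end_near. Qed.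

Lemma dseries_unique s k l f F G : 1 < s ->
  dseries s k f F -> dseries s l f G -> F = G.
Proof.
by move=> s1 /(dseries_cvg s1) fF /(dseries_cvg s1) fG; exact: cvg_unique fF fG.
Qed.

Lemma dseries_ge_first s k f F : 1 < s -> (forall n, (0 < n)%N -> 0 <= f n) ->
  dseries s k f F -> f 1 <= F.
Proof.
move=> s1 f0 /(dseries_cvg s1) fF; rewrite -(cvg_lim _ fF)//.
apply: limr_ge; first by apply/cvg_ex; exists F.
near=> N; have N0 : (0 < N)%N by near: N; exists 1%N.
rewrite big_ltn// powR1 divr1 lerDl big_nat_cond; apply: sumr_ge0 => n.
by rewrite andbT => /andP[n1 _]; rewrite divr_ge0 ?powR_ge0 ?f0 ?(ltnW n1).
Unshelve. all: end_near. Qed.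

Lemma dseries_gt0 s k f F : 1 < s -> (forall n, (0 < n)%N -> 0 <= f n) -> 0 < f 1 ->
  dseries s k f F -> 0 < F.
Proof.
by move=> s1 f0 f1 fF; rewrite (lt_le_trans f1) ?(dseries_ge_first s1 f0 fF).
Qed.

Lemma dseries2P k f F : dseries 2 k f F <->
  log_bounded k (fun x => x * (summatory (fun n => f n / n%:R ^+ 2) x - F)).
Proof.
have dseries2E x : 1 <= x ->
    x `^ (2 - 1) * (summatory (fun n => f n / n%:R `^ 2) x - F) =
    x * (summatory (fun n => f n / n%:R ^+ 2) x - F).
  move=> x1; rewrite (_ : 2 - 1 = 1) ?powRr1 ?(le_trans _ x1)//; last by ring.
  by congr (_ * (_ - _)); apply: eq_summatory => n _ _; rewrite powR_mulrn.
by split; apply: eq_log_bounded => x /dseries2E.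
Qed.

Lemma sum_truncn_asymp k f F : harmonic_bound k f -> dseries 2 k f F ->
  log_bounded k (fun x =>
    summatory (fun n => f n / n%:R * (Num.truncn (x / n%:R))%:R) x - F * x).
Proof.
move=> bf /dseries2P fF; pose frac y : R := y - (Num.truncn y)%:R.
have frac_bounded : log_bounded 0 frac.
  exists 1 => // y y1; rewrite mulr1.
  have [_ Ny yN _] := truncn_ge1_bounds y1.
  by rewrite ger0_norm /frac; lra.
have := log_bounded_weighted_sum bf frac_bounded; rewrite addn0.
move/(log_boundedB fF); apply: eq_log_bounded => x x1.
rewrite mulrBr [F * x]mulrC -summatoryZl addrAC -summatoryB; congr (_ - _).
by apply: eq_summatory => n n0 _; rewrite /frac; field; rewrite pnatr_eq0 -lt0n.
Qed.

End DirichletSeries.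

(** * The zeta function and its derivative *)

Section Zeta.
Variable R : realType.
Implicit Types (h s v Z : R) (k n : nat).

Lemma dseries_zeta s : 1 < s -> dseries s 0 arith_one (zeta s).
Proof.
move=> s1; have [n _|F sF] := @dseries_exists R s 0 arith_one 1 s1.
  by rewrite normr1 mulr1.
suff -> : zeta s = F by [].
have := dseries_cvg s1 sF; under eq_fun do under eq_bigr do rewrite mul1r.
move=> F_lim; apply/cvg_lim => //.
rewrite (_ : series _ = fun N => \sum_(1 <= n < N.+1) (n%:R `^ s)^-1)//.
by apply/funext => N; rewrite /series/= big_add1.
Qed.

Lemma zeta_gt0 s : 1 < s -> 0 < zeta s.
Proof. by move=> s1; apply: dseries_gt0 s1 _ _ (dseries_zeta s1). Qed.

Lemma expR_sub_affine_le v : `|expR v - 1 - v| <= v ^+ 2 * expR `|v|.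
Proof.
have ge_affine := expR_ge1Dx v.
have sub1_le : expR v - 1 <= v * expR v.
  have := expR_ge1Dx (- v); have := expRxMexpNx_1 v; have := expR_gt0 v.
  by move: (expR v) (expR (- v)) => a b; nra.
rewrite ger0_norm; last by lra.
have [v0|v0] := leP 0 v; first by rewrite ger0_norm//; nra.
have norm_ge1 : 1 <= expR `|v| by rewrite -expR0 ler_expR.
have : v ^+ 2 <= v ^+ 2 * expR `|v| by rewrite ler_peMr ?sqr_ge0.
by apply: le_trans; nra.
Qed.

Lemma powRN_taylor s h n : (0 < n)%N -> `|h| <= (s - 1) / 2 ->
  `|(n%:R `^ (s + h))^-1 - (n%:R `^ s)^-1 + h * (arith_ln R n / n%:R `^ s)| <=
  h ^+ 2 * (arith_ln R n ^+ 2 / n%:R `^ ((s + 1) / 2)).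
Proof.
move=> n0 hs; have n0' : n%:R != 0 :> R by rewrite pnatr_eq0 -lt0n.
have t0 := arith_ln_ge0 R n; set t := arith_ln R n in t0 *.
have powRE x : (n%:R `^ x)^-1 = expR (- (x * t)) :> R.
  by rewrite /powR (negbTE n0') expRN.
rewrite !powRE.
have -> : expR (- ((s + h) * t)) - expR (- (s * t)) + h * (t * expR (- (s * t))) =
    expR (- (s * t)) * (expR (- (h * t)) - 1 - - (h * t)).
  by rewrite mulrDl opprD expRD; ring.
rewrite normrM ger0_norm ?expR_ge0//.
apply: le_trans (ler_wpM2l (expR_ge0 _) (expR_sub_affine_le _)) _.
rewrite sqrrN exprMn mulrCA -[leLHS]mulrA ler_wpM2l ?sqr_ge0// ler_wpM2l ?sqr_ge0//.
rewrite -expRD ler_expR normrN normrM (ger0_norm t0).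
have -> : - ((s + 1) / 2 * t) = - (s * t) + (s - 1) / 2 * t by field.
by rewrite lerD2l ler_wpM2r.
Qed.

Lemma zeta_taylor s k Z : 1 < s -> dseries s k (arith_ln R) Z ->
  exists W : R, forall h, `|h| <= (s - 1) / 2 ->
    `|zeta (s + h) - zeta s + h * Z| <= h ^+ 2 * W.
Proof.
move=> s1 sZ; pose r : R := (s + 1) / 2; have r1 : 1 < r by rewrite /r; lra.
have [n n0|W rW] := @dseries_exists R r 2 (fun n => arith_ln R n ^+ 2) 1 r1.
  rewrite mul1r ger0_norm ?sqr_ge0// lerXn2r ?nnegrE ?arith_ln_ge0//.
    by rewrite log1_ge0// ler1n.
  by rewrite lerDr.
exists W => h hs; have sh1 : 1 < s + h by move: hs; rewrite ler_norml; lra.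
pose S f t N : R := \sum_(1 <= n < N.+1) f n / n%:R `^ t.
have diff_cvg : S arith_one (s + h) N - S arith_one s N + h * S (arith_ln R) s N
    @[N --> \oo] --> zeta (s + h) - zeta s + h * Z.
  apply: cvgD; last by apply: cvgMl_tmp; exact: dseries_cvg sZ.
  apply: cvgB; first exact: dseries_cvg (dseries_zeta sh1).
  exact: dseries_cvg (dseries_zeta s1).
have bound_cvg : h ^+ 2 * S (fun n => arith_ln R n ^+ 2) r N
    @[N --> \oo] --> h ^+ 2 * W.
  by apply: cvgMl_tmp; exact: dseries_cvg rW.
apply: ler_cvg_to (cvg_norm diff_cvg) bound_cvg _; near=> N; rewrite /S.
rewrite !mulr_sumr -sumrB -big_split/=; apply: le_trans (ler_norm_sum _ _ _) _.
by apply: ler_sum_nat => n /andP[n0 _]; rewrite /arith_one !mul1r powRN_taylor.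
Unshelve. all: end_near. Qed.

Lemma is_derive_zeta s k Z : 1 < s -> dseries s k (arith_ln R) Z ->
  is_derive s 1 (@zeta R) (- Z).
Proof.
move=> s1 sZ; have [W zetaW] := zeta_taylor s1 sZ.
suff diff_quot : h^-1 *: (zeta (h *: 1 + s) - zeta s) @[h --> 0^'] --> (- Z : R).
  by apply: DeriveDef; [apply/cvg_ex; exists (- Z)|exact: cvg_lim].
apply/cvgrPdist_le => e e0; near=> h.
have h0 : h != 0 by near: h; exact: nbhs_dnbhs_neq.
have hs : `|h| <= (s - 1) / 2.
  by near: h; apply: dnbhs0_le; rewrite divr_gt0// subr_gt0.
have he : `|h| <= e / (`|W| + 1).
  by near: h; apply: dnbhs0_le; rewrite divr_gt0// ltr_wpDl.
have := zetaW h hs; rewrite /GRing.scale/= mulr1 [h + s]addrC => zetaWh.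
rewrite -normrN (_ : - _ = h^-1 * (zeta (s + h) - zeta s + h * Z)); last by field.
rewrite normrM normfV ler_pdivrMl ?normr_gt0//; apply: le_trans zetaWh _.
rewrite -real_normK ?num_real// expr2 -mulrA ler_wpM2l//.
rewrite ler_pdivlMr ?ltr_wpDl// in he; apply: le_trans he.
by rewrite ler_wpM2l// (le_trans (ler_norm W))// lerDl.
Unshelve. all: end_near. Qed.

Lemma dseries_dzeta s : 1 < s -> dseries s 1 (arith_ln R) (- dzeta s).
Proof.
move=> s1; have [n n0|Z sZ] := @dseries_exists R s 1 (arith_ln R) 1 s1.
  by rewrite mul1r expr1 ger0_norm ?arith_ln_ge0// lerDr.
by have := is_derive_zeta s1 sZ => dz; rewrite /dzeta derive1E derive_val opprK.
Qed.

End Zeta.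

(** * Convolution powers of the Moebius function *)

Section MoebiusPowers.
Variable R : realType.
Implicit Types (s : R) (q : nat).
Local Notation mu := (moebius R).

Lemma harmonic_bound_moebius : harmonic_bound 1 mu.
Proof.
by apply: (@harmonic_bound_bounded _ _ 1) => n _; exact: norm_moebius_le1.
Qed.

Lemma dseries_moebius s : 1 < s -> dseries s 0 mu (zeta s)^-1.
Proof.
move=> s1; have [n _|M sM] := @dseries_exists R s 0 mu 1 s1.
  by rewrite mulr1 norm_moebius_le1.
suff -> : (zeta s)^-1 = M by [].
have z0 : zeta s != 0 by rewrite gt_eqF ?zeta_gt0.
apply: (mulIf z0); rewrite mulVf//; apply/esym.
apply: (@dseries_unique _ s 1 0 dirichlet_unit); last exact: dseries_unit; first by [].
apply: eq_dseries (@dirichlet_moebius_one R) _; rewrite -[1%N]addn0.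
exact: dseries_dirichlet harmonic_bound_moebius sM (dseries_zeta s1).
Qed.

Lemma dseries_moebius_ln s : 1 < s ->
  dseries s 1 (fun n => mu n * arith_ln R n) (dzeta s / zeta s ^+ 2).
Proof.
move=> s1; have z0 : zeta s != 0 by rewrite gt_eqF ?zeta_gt0.
have [n _|M sM] := @dseries_exists R s 1 (fun n => mu n * arith_ln R n) 1 s1.
  rewrite normrM ler_pM ?norm_moebius_le1// ger0_norm ?arith_ln_ge0//.
  by rewrite expr1 lerDr.
suff zM : M * zeta s + (zeta s)^-1 * - dzeta s = 0.
  suff <- : M = dzeta s / zeta s ^+ 2 by [].
  by apply: (mulIf z0); apply: subr0_eq; rewrite -zM; field.
apply: (@dseries_unique _ s 2 0 (fun=> 0)); [by []| |exact: dseries0].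
apply: (@eq_dseries _ _ _ (fun n => dirichlet (fun k => mu k * arith_ln R k) arith_one n
    + dirichlet mu (fun k => arith_one k * arith_ln R k) n)) => [n n0|].
  rewrite -dirichlet_additiveM//; last exact: arith_lnM.
  rewrite dirichlet_moebius_one// /dirichlet_unit.
  by case: eqP => [->|_]; rewrite /arith_ln ?ln1 ?mulr0 ?mul0r.
apply: dseriesD.
  have mu_ln_bound := harmonic_bound_lnM harmonic_bound_moebius.
  exact: dseries_dirichlet mu_ln_bound sM (dseries_zeta s1).
apply: dseries_dirichlet harmonic_bound_moebius (dseries_moebius s1) _ => //.
by apply: eq_dseries (dseries_dzeta s1) => n _; rewrite mul1r.
Qed.

Lemma harmonic_bound_moebius_pow q : harmonic_bound q.+1 (dirichlet_pow mu q).
Proof.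
elim: q => [|q IH]; first exact: harmonic_bound_moebius.
by rewrite -add1n; apply: harmonic_bound_dirichlet IH; exact: harmonic_bound_moebius.
Qed.

(* Writing [mu * ln] as the von Mangoldt function saves a logarithm. *)
Lemma harmonic_bound_moebius_pow_ln q :
  harmonic_bound q.+2 (dirichlet (dirichlet_pow mu q) (arith_ln R)).
Proof.
elim: q => [|q IH].
  apply: harmonic_bound_le (harmonic_bound_arith_ln R) => n n0.
  by rewrite !ger0_norm ?arith_ln_ge0 ?von_mangoldt_ge0 ?von_mangoldt_le.
apply: harmonic_bound_le (harmonic_bound_dirichlet harmonic_bound_moebius IH) => n n0.
by rewrite dirichletA.
Qed.

Lemma dseries_moebius_pow s q : 1 < s ->
  dseries s q (dirichlet_pow mu q) ((zeta s)^-1 ^+ q.+1).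
Proof.
move=> s1; elim: q => [|q IH]; first by rewrite expr1; exact: dseries_moebius.
rewrite exprS -add1n; apply: dseries_dirichlet (dseries_moebius s1) IH => //.
exact: harmonic_bound_moebius.
Qed.

Lemma dseries_moebius_pow_ln s q : 1 < s ->
  dseries s q.+1 (fun n => dirichlet_pow mu q n * arith_ln R n)
    (q.+1%:R * (zeta s)^-1 ^+ q.+2 * dzeta s).
Proof.
move=> s1; have z0 : zeta s != 0 by rewrite gt_eqF ?zeta_gt0.
have mu_ln := dseries_moebius_ln s1; elim: q => [|q IH].
  by rewrite mul1r exprVn mulrC.
have -> : q.+2%:R * (zeta s)^-1 ^+ q.+3 * dzeta s =
    (zeta s)^-1 ^+ q.+1 * (dzeta s / zeta s ^+ 2) +
    (zeta s)^-1 * (q.+1%:R * (zeta s)^-1 ^+ q.+2 * dzeta s).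
  by rewrite -[q.+2%:R]natr1 !(exprS (zeta s)^-1); field.
apply: (@eq_dseries _ _ _ (fun n =>
    dirichlet (dirichlet_pow mu q) (fun k => mu k * arith_ln R k) n +
    dirichlet mu (fun k => dirichlet_pow mu q k * arith_ln R k) n)) => [n n0|].
  rewrite (dirichlet_additiveM _ _ (@arith_lnM R))//; congr (_ + _).
  exact: dirichletC.
apply: dseriesD.
  rewrite -(addn1 q.+1); apply: dseries_dirichlet (dseries_moebius_pow q s1) mu_ln.
    by rewrite addn1 ltnW.
  exact: harmonic_bound_moebius_pow.
rewrite -add1n; apply: dseries_dirichlet (dseries_moebius s1) IH => //.
exact: harmonic_bound_moebius.
Qed.

End MoebiusPowers.

(** * Stirling's formula and harmonic sums, up to the constants *)

Section StirlingHarmonic.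
Variable R : realType.
Implicit Types n : nat.

Lemma natr_succ_ratio n : (0 < n)%N -> [/\ 0 < n%:R :> R, 1 < n.+1%:R / n%:R :> R &
  ln n.+1%:R - ln n%:R = ln (n.+1%:R / n%:R) :> R].
Proof.
move=> n0; have n0' : 0 < n%:R :> R by rewrite ltr0n.
by rewrite ltr_pdivlMr// mul1r ltr_nat ln_div ?posrE ?ltr0n.
Qed.

Lemma ln_nat_succ_gt_midpoint n : (0 < n)%N ->
  2 / (2 * n%:R + 1) < ln n.+1%:R - ln n%:R :> R.
Proof.
move=> /natr_succ_ratio[n0 r1 ->].
rewrite (_ : 2 / _ = 2 * (n.+1%:R / n%:R - 1) / (n.+1%:R / n%:R + 1)) ?ln_gt_pade//.
by rewrite -natr1; field; rewrite !gt_eqF//; lra.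
Qed.

Lemma ln_nat_succ_lt_trapezoid n : (0 < n)%N ->
  ln n.+1%:R - ln n%:R < (n%:R^-1 + n.+1%:R^-1) / 2 :> R.
Proof.
move=> /natr_succ_ratio[n0 r1 ->].
rewrite (_ : _ / 2 = (n.+1%:R / n%:R - (n.+1%:R / n%:R)^-1) / 2) ?ln_lt_half_subV//.
by rewrite -natr1; field; rewrite !gt_eqF//; lra.
Qed.

Lemma ln_factS n : ln n.+1`!%:R = ln n.+1%:R + ln n`!%:R :> R.
Proof. by rewrite factS natrM lnM ?posrE ?ltr0n ?fact_gt0. Qed.

Lemma sum_ln_nat n : \sum_(1 <= k < n.+1) ln k%:R = ln n`!%:R :> R.
Proof.
elim: n => [|n IH]; first by rewrite big_nil ln1.
by rewrite big_nat_recr//= IH ln_factS addrC.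
Qed.

Definition stirling_seq n : R := ln n`!%:R - (n%:R + 2^-1) * ln n%:R + n%:R.

Lemma stirling_seq_step n : (0 < n)%N ->
  0 < stirling_seq n - stirling_seq n.+1 <= 4^-1 / n%:R - 4^-1 / n.+1%:R.
Proof.
move=> n0; have n0' : 0 < n%:R :> R by rewrite ltr0n.
have -> : stirling_seq n - stirling_seq n.+1 =
    (n%:R + 2^-1) * (ln n.+1%:R - ln n%:R) - 1.
  by rewrite /stirling_seq ln_factS -natr1; field.
have nh : 0 < n%:R + 2^-1 :> R by lra.
rewrite subr_gt0 -ltr_pdivrMl// lerBlDr -ler_pdivlMl//; apply/andP; split.
  apply: le_lt_trans (ln_nat_succ_gt_midpoint n0).
  by rewrite mulr1 -[2 / _]invf_div ler_pV2 ?inE ?unitfE ?gt_eqF; lra.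
rewrite (_ : _ * (_ + 1) = (n%:R^-1 + n.+1%:R^-1) / 2).
  exact: ltW (ln_nat_succ_lt_trapezoid n0).
by rewrite -natr1; field; rewrite !gt_eqF//; lra.
Qed.

Lemma stirling_seq_cvg : exists c : R,
  forall n, (0 < n)%N -> 0 < stirling_seq n - c <= 4^-1 / n%:R.
Proof.
have [n n0|n _|c s_cvg sc] := @telescoping_cvg R stirling_seq (fun n => 4^-1 / n%:R).
- by have /andP[/ltW ? ?] := stirling_seq_step n0; rewrite distrC ger0_norm.
- by rewrite divr_ge0.
have sS_cvg : stirling_seq n.+1 @[n --> \oo] --> c by rewrite (cvg_shiftS stirling_seq).
have sS_decr : nonincreasing_seq (fun n => stirling_seq n.+1).
  apply/nonincreasing_seqP => n.
  by have /andP[/ltW + _] := @stirling_seq_step n.+1 isT; rewrite subr_ge0.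
exists c => n n0; rewrite (le_trans (ler_norm _) (sc n n0)) andbT subr_gt0.
have /andP[+ _] := stirling_seq_step n0; rewrite subr_gt0; apply: le_lt_trans.
rewrite -(cvg_lim _ sS_cvg)//.
exact: nonincreasing_cvgn_ge sS_decr (cvgP _ sS_cvg) n.
Qed.

Lemma harmonic_sum_asymp n : (0 < n)%N ->
  `|\sum_(1 <= k < n.+1) k%:R^-1 - ln n%:R - 2^-1 / n%:R - @euler_gamma R|
    <= 8^-1 / n%:R ^+ 2.
Proof.
pose h n : R := \sum_(1 <= k < n.+1) k%:R^-1 - ln n%:R - 2^-1 / n%:R.
have [m m0|m _|l h_cvg hl] := @telescoping_cvg R h (fun n => 8^-1 / n%:R ^+ 2).
- have m0' : 0 < m%:R :> R by rewrite ltr0n.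
  have -> : h m.+1 - h m = (m%:R^-1 + m.+1%:R^-1) / 2 - (ln m.+1%:R - ln m%:R).
    by rewrite /h big_nat_recr//= -!natr1; field; rewrite !gt_eqF//; lra.
  rewrite ger0_norm ?subr_ge0 ?(ltW (ln_nat_succ_lt_trapezoid m0))//.
  apply: le_trans (lerB (lexx _) (ltW (ln_nat_succ_gt_midpoint m0))) _.
  rewrite -[m.+1%:R]natr1 -subr_ge0.
  have -> : 8^-1 / m%:R ^+ 2 - 8^-1 / (m%:R + 1) ^+ 2 -
      ((m%:R^-1 + (m%:R + 1)^-1) / 2 - 2 / (2 * m%:R + 1)) =
      1 / (8 * m%:R ^+ 2 * (m%:R + 1) ^+ 2 * (2 * m%:R + 1)) :> R.
    by field; rewrite !gt_eqF//; lra.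
  by rewrite divr_ge0// !mulr_ge0 ?exprn_ge0//; lra.
- by rewrite divr_ge0 ?exprn_ge0.
suff -> : euler_gamma = l by exact: hl.
apply/cvg_lim => //.
have -> : (fun n => \sum_(1 <= k < n.+1) k%:R^-1 - ln n%:R) =
          (fun n => h n + 2^-1 / n%:R) :> (nat -> R).
  by apply/funext => m; rewrite /h subrK.
by rewrite -[X in _ --> X]addr0; apply: cvgD => //; exact: cvg_div_nat.
Qed.

End StirlingHarmonic.

(** * Wallis' product and the constant in Stirling's formula *)

Section Wallis.
Variable R : realType.
Implicit Types (x : R) (n : nat).

(* The antiderivative of [cos ^+ n] vanishing at 0, by the reduction formula. *)
Fixpoint cosX_primitive n x : R :=
  match n with
  | 0 => x
  | 1 => sin x
  | m.+2 => (sin x * cos x ^+ m.+1 + m.+1%:R * cosX_primitive m x) / m.+2%:R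
  end.

Lemma is_derive_cosX_primitive n x :
  is_derive x 1 (cosX_primitive n) (cos x ^+ n).
Proof.
suff [] : is_derive x 1 (cosX_primitive n) (cos x ^+ n) /\
  is_derive x 1 (cosX_primitive n.+1) (cos x ^+ n.+1) by [].
elim: n => [|n [IH1 IH2]].
  split; first by rewrite expr0; exact: is_derive_id.
  by rewrite expr1; exact: is_derive_sin.
split=> //.
rewrite (_ : cosX_primitive n.+2 = fun x => n.+2%:R^-1 *
   (sin x * cos x ^+ n.+1 + n.+1%:R * cosX_primitive n x)); last first.
  by apply/funext => y /=; rewrite mulrC.
have dX : is_derive x 1 (fun y => cos y ^+ n.+1) ((n.+1%:R * cos x ^+ n) *: - sin x).
  rewrite (_ : (fun y => cos y ^+ n.+1) = (@cos R) ^+ n.+1); first exact: is_deriveX.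
  by apply/funext => y; rewrite fctE.
apply: is_derive_eq; rewrite /GRing.scale/=.
have sin2 : sin x ^+ 2 = 1 - cos x ^+ 2 by rewrite -(cos2Dsin2 x) addrC addKr.
have n2 : n%:R + 1 + 1 != 0 :> R by rewrite gt_eqF// !ltr_wpDl.
transitivity ((n%:R + 1 + 1)^-1 * (cos x ^+ n.+2 + (n%:R + 1) * cos x ^+ n *
   (1 - sin x ^+ 2)) : R).
  by rewrite -!natr1 !exprS; ring.
by rewrite sin2 !exprS; field.
Qed.

Lemma cosX_primitive0 n : cosX_primitive n 0 = 0.
Proof.
suff [] : cosX_primitive n 0 = 0 /\ cosX_primitive n.+1 0 = 0 by [].
elim: n => [|n [IH1 IH2]]; first by rewrite /= sin0.
by split => //=; rewrite sin0 IH1 mul0r mulr0 addr0 mul0r.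
Qed.

Definition wallis_int n : R := cosX_primitive n (pi / 2).

Lemma wallis_intSS n : wallis_int n.+2 = n.+1%:R / n.+2%:R * wallis_int n.
Proof. by rewrite /wallis_int/= cos_pihalf expr0n/= mulr0 add0r mulrAC. Qed.

Lemma wallis_int_gt0 n : 0 < wallis_int n.
Proof.
suff /andP[] : (0 < wallis_int n) && (0 < wallis_int n.+1) by [].
elim: n => [|n /andP[IH1 IH2]].
  by rewrite /wallis_int/= sin_pihalf ltr01 andbT divr_gt0// pi_gt0.
by rewrite IH2/= wallis_intSS mulr_gt0// divr_gt0// ltr0n.
Qed.

Lemma wallis_int_decr n : wallis_int n.+1 <= wallis_int n.
Proof.
have pi2 : 0 < pi / 2 :> R by rewrite divr_gt0 ?pi_gt0.
pose f x := cosX_primitive n x - cosX_primitive n.+1 x.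
have [x _|c /andP[c0 cpi] fE] :=
    @is_derive_MVT R f (fun x => cos x ^+ n - cos x ^+ n.+1) 0 (pi / 2) pi2.
  have dn := is_derive_cosX_primitive n x.
  have dnS := is_derive_cosX_primitive n.+1 x.
  exact: is_deriveB.
have -> : wallis_int n.+1 = wallis_int n - (f (pi / 2) - f 0).
  by rewrite /f !cosX_primitive0 /wallis_int; ring.
rewrite fE gerBl mulr_ge0 ?subr0 ?(ltW pi2)// exprS -[X in X - _]mul1r -mulrBl.
rewrite mulr_ge0 ?subr_ge0 ?cos_le1// exprn_ge0// ltW// cos_gt0_pihalf// cpi andbT.
by rewrite (lt_trans _ c0)// oppr_lt0.
Qed.

Lemma wallis_int_prod n : n.+1%:R * wallis_int n * wallis_int n.+1 = pi / 2.
Proof.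
elim: n => [|n IH]; first by rewrite /wallis_int/= sin_pihalf mulr1 mul1r.
by rewrite -IH wallis_intSS; field; rewrite gt_eqF// ltr_wpDr.
Qed.

Lemma ln_wallis_int_bounds n : (0 < n)%N ->
  2 * ln (wallis_int n) + ln n%:R <= ln (pi / 2) <= 2 * ln (wallis_int n) + ln n.+1%:R.
Proof.
case: n => [//|n] _; have W := wallis_int_gt0.
have pi2 : 0 < pi / 2 :> R by rewrite divr_gt0 ?pi_gt0.
have ln_mulr2 a x : 0 < a -> 0 < x -> 2 * ln x + ln a = ln (a * x * x).
  by move=> a0 x0; rewrite !lnM ?posrE ?mulr_gt0//; ring.
rewrite !ln_mulr2 ?ltr0n ?W// !ler_ln ?posrE ?pi2 ?mulr_gt0 ?ltr0n ?W//.
apply/andP; split.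
  rewrite -(wallis_int_prod n) -mulrA -[leRHS]mulrA ler_wpM2l//.
  by rewrite ler_wpM2r ?wallis_int_decr// ltW ?W.
by rewrite -(wallis_int_prod n.+1) ler_wpM2l ?wallis_int_decr// mulr_ge0// ltW ?W.
Qed.

Lemma ln_wallis_int_even n :
  ln (wallis_int n.*2) =
  ln (pi / 2) + ln n.*2`!%:R - 2 * n%:R * ln 2 - 2 * ln n`!%:R :> R.
Proof.
elim: n => [|n IH]; first by rewrite /wallis_int/= ln1 !(mulr0, mul0r, addr0, subr0).
rewrite doubleS wallis_intSS [in LHS]lnM ?posrE ?wallis_int_gt0 ?divr_gt0 ?ltr0n//.
rewrite IH !ln_factS [ln (_.+1%:R / _)]ln_div ?posrE ?ltr0n//.
have -> : n.*2.+2%:R = 2 * n.+1%:R :> R by rewrite -natrM mul2n doubleS.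
by rewrite [in ln (2 * _)]lnM ?posrE ?ltr0n// -[n.+1%:R]natr1; ring.
Qed.

Definition ln_sqrt2pi : R := ln (Num.sqrt (2 * pi)).

Lemma ln_sqrt2piE : 2 * ln_sqrt2pi = ln (pi / 2) + 2 * ln 2.
Proof.
have pi0 := @pi_gt0 R; have pi2 : 0 < 2 * pi :> R by rewrite mulr_gt0.
rewrite mulr_natl /ln_sqrt2pi -lnXn ?sqrtr_gt0// sqr_sqrtr ?ltW//.
by rewrite ln_div ?lnM ?posrE//; ring.
Qed.

Lemma stirling_bounds n : (0 < n)%N ->
  0 < stirling_seq R n - ln_sqrt2pi <= 4^-1 / n%:R.
Proof.
have [c sc] := stirling_seq_cvg R; suff -> : ln_sqrt2pi = c by exact: sc.
suff : 2 * (c - ln_sqrt2pi) = 0 by lra.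
apply: (@norm_le_div_nat_eq0 _ _ 3) => {}n n0.
have n0' : 0 < n%:R :> R by rewrite ltr0n.
have := @ln_wallis_int_bounds n.*2; rewrite double_gt0 => /(_ n0).
have := @ln_nat_succ_le R n.*2; rewrite double_gt0 => /(_ n0).
have := sc _ n0; have := sc n.*2; rewrite double_gt0 => /(_ n0).
have := ln_sqrt2piE; rewrite ln_wallis_int_even /stirling_seq.
have -> : n.*2%:R = 2 * n%:R :> R by rewrite -natrM mul2n.
rewrite [in ln (2 * n%:R)]lnM ?posrE// invfM.
have : 0 < n%:R^-1 :> R by rewrite invr_gt0.
rewrite -[3 / _]/(3 * n%:R^-1) -[4^-1 / _]/(4^-1 * n%:R^-1); move: (n%:R^-1) => u.
by rewrite ler_norml; lra.
Qed.

End Wallis.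

(** * The divisor sum weighted by logarithms *)

Section DivisorLogSum.
Variable R : realType.
Implicit Types (x y z : R).

(* In terms of [z] itself rather than its integer part [N], the harmonic sum has
   the sawtooth term [(z - N - 1/2) / z]. *)
Lemma summatory_inv_asymp z : 1 <= z ->
  `|summatory (fun n => n%:R^-1) z
    - (ln z + euler_gamma - (z - (Num.truncn z)%:R - 2^-1) / z)| <= 5 / z ^+ 2.
Proof.
move=> z1; have [N0 Nz zN z2N] := truncn_ge1_bounds z1.
have := harmonic_sum_asymp R N0; rewrite /summatory; set H := \sum_(_ <= _ < _) _.
have {}N0 : 0 < (Num.truncn z)%:R :> R by rewrite ltr0n.
move: (Num.truncn z)%:R N0 Nz zN z2N => N N0 Nz zN z2N.
have z0 : 0 < z by apply: lt_le_trans z1.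
set h := H - _ - _ - _ => h_le; have := ln_sub_unit_bounds N0 Nz (ltW zN).
set t := _ - (ln z - ln N); pose d := z - N => t_bounds.
have -> : H - (ln z + euler_gamma - (z - N - 2^-1) / z) =
    h + t + d * (2^-1 - d) * (N^-1 * z^-1).
  by rewrite /h /t /d; field; rewrite !gt_eqF.
have iNz : 0 <= N^-1 * z^-1 <= N^-1 ^+ 2.
  rewrite mulr_ge0 ?invr_ge0 ?(ltW N0) ?(ltW z0)//=.
  by rewrite expr2 ler_pM2l ?invr_gt0// lef_pV2 ?posrE.
have d_saw : `|d * (2^-1 - d) * (N^-1 * z^-1)| <= 2^-1 * N^-1 ^+ 2.
  have /andP[iNz0 iNz_le] := iNz; rewrite normrM [`|N^-1 * _|]ger0_norm// ler_pM//.
  have d0 : 0 <= d by rewrite subr_ge0.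
  have d1 : d <= 1 by rewrite lerBlDl ltW.
  by rewrite ler_norml; nra.
apply: (@le_trans _ _ (9 / 8 * N^-1 ^+ 2)).
  rewrite -[8^-1 / _]/(8^-1 * (N ^+ 2)^-1) -exprVn in h_le.
  by move: h_le t_bounds d_saw; rewrite !ler_norml; lra.
rewrite ler_pdivlMr ?exprn_gt0//.
rewrite (_ : _ * z ^+ 2 = 9 / 8 * (N^-1 * z) ^+ 2); last by ring.
have : 0 <= N^-1 * z by rewrite mulr_ge0 ?invr_ge0 ?ltW.
have : N^-1 * z <= 2 by rewrite ler_pdivrMl// mulrC.
by move: (N^-1 * z) => r; nra.
Qed.

Definition ln_ratio_sum z : R := summatory (fun n => ln (z / n%:R)) z.

Lemma ln_ratio_sumE z : 0 < z ->
  ln_ratio_sum z = (Num.truncn z)%:R * ln z - ln (Num.truncn z)`!%:R.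
Proof.
move=> z0; rewrite -sum_ln_nat -summatory_cst -summatoryB.
by apply: eq_summatory => n n0 _; rewrite ln_div ?posrE ?ltr0n.
Qed.

Lemma ln_ratio_sum_asymp z : 1 <= z ->
  `|ln_ratio_sum z - (z - ln z / 2 - ln_sqrt2pi R)| <= 2 / z.
Proof.
move=> z1; rewrite ln_ratio_sumE ?(lt_le_trans _ z1)//.
have [N0 Nz zN z2N] := truncn_ge1_bounds z1.
have := stirling_bounds R N0; rewrite /stirling_seq.
have {}N0 : 0 < (Num.truncn z)%:R :> R by rewrite ltr0n.
move: (Num.truncn z)%:R (ln _`!%:R) N0 Nz zN z2N => N lf N0 Nz zN z2N s_bounds.
have := ln_sub_unit_bounds N0 Nz (ltW zN).
set s := _ - ln_sqrt2pi R in s_bounds; set t := _ - (ln z - ln N) => t_bounds.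
have z0 : 0 < z by apply: lt_le_trans z1.
have -> : N * ln z - lf - (z - ln z / 2 - ln_sqrt2pi R) =
    - (N * t) + (ln z - ln N) / 2 - s.
  by rewrite /s /t; field; rewrite gt_eqF.
have iN0 : 0 < N^-1 by rewrite invr_gt0.
have Nt : 0 <= N * t <= N^-1 / 2.
  have -> : N^-1 / 2 = N * (N^-1 ^+ 2 / 2) by field; rewrite gt_eqF.
  by have /andP[t0 t1] := t_bounds; rewrite mulr_ge0 ?(ltW N0)// ler_pM2l.
have ln_zN : 0 <= ln z - ln N <= N^-1.
  rewrite subr_ge0 ler_ln ?posrE// Nz/=.
  have := ler_wpM2r (ltW iN0) (_ : z - N <= 1); rewrite mul1r lerBlDl => /(_ (ltW zN)).
  by have /andP[+ _] := t_bounds; rewrite /t; lra.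
apply: (@le_trans _ _ N^-1); last by rewrite ler_pdivlMr// ler_pdivrMl// mulrC.
rewrite -[4^-1 / _]/(4^-1 * N^-1) in s_bounds; rewrite ler_norml; lra.
Qed.

Definition divisor_ln_sum y : R := summatory (fun n => arith_tau R n * ln (y / n%:R)) y.

Lemma divisor_ln_sum_pairs y : 0 <= y ->
  divisor_ln_sum y = \sum_(1 <= a < (Num.truncn y).+1)
    \sum_(1 <= b < (Num.truncn y %/ a).+1) ln (y / (a * b)%:R).
Proof.
move=> y0; rewrite /divisor_ln_sum.
under eq_summatory do rewrite -dirichlet_one_one.
rewrite /summatory (sum_dirichlet _ _ _ (fun n => ln (y / n%:R))).
by apply: eq_bigr => a _; rewrite mul1r; apply: eq_bigr => b _; rewrite mul1r.
Qed.

Lemma divisor_ln_sum_hyperbola x : 1 <= x ->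
  divisor_ln_sum (x ^+ 2) = 2 * summatory (fun a => ln_ratio_sum (x ^+ 2 / a%:R)) x
    - 2 * (Num.truncn x)%:R * ln_ratio_sum x.
Proof.
move=> x1; have x0 : 0 < x by apply: lt_le_trans x1.
have [N0 Nx xN _] := truncn_ge1_bounds x1; rewrite divisor_ln_sum_pairs ?sqr_ge0//.
set M := Num.truncn (x ^+ 2); set N := Num.truncn x in N0 Nx xN *.
have NM : (N * N <= M < N.+1 * N.+1)%N.
  rewrite truncn_ge_nat ?sqr_ge0// truncn_lt_nat ?sqr_ge0// !natrM -!expr2 -natr1.
  by rewrite lerXn2r ?ltrXn2r ?nnegrE ?addr_ge0// ltW.
rewrite (hyperbola_sum _ N0 NM).
have inner a : (0 < a)%N -> \sum_(1 <= b < (M %/ a).+1) ln (x ^+ 2 / (a * b)%:R) =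
    ln_ratio_sum (x ^+ 2 / a%:R).
  move=> a0; rewrite /ln_ratio_sum /summatory truncn_divn ?sqr_ge0//.
  by apply: eq_bigr => b _; rewrite natrM invfM mulrA.
have corner : \sum_(1 <= a < N.+1) \sum_(1 <= b < N.+1) ln (x ^+ 2 / (a * b)%:R) =
    2 * N%:R * ln_ratio_sum x.
  rewrite (_ : \sum_(1 <= a < N.+1) _ = summatory (fun a => summatory
      (fun b => ln (x / a%:R) + ln (x / b%:R)) x) x); last first.
    apply: eq_big_nat => a /andP[a0 _]; apply: eq_big_nat => b /andP[b0 _].
    rewrite -lnM ?posrE ?divr_gt0 ?ltr0n//; congr ln.
    by rewrite natrM; field; rewrite !pnatr_eq0 -!lt0n a0 b0.
  under eq_summatory do rewrite summatoryD summatory_cst -/(ln_ratio_sum x).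
  by rewrite summatoryD summatoryZl summatory_cst -/(ln_ratio_sum x); ring.
rewrite corner; congr (_ - _); rewrite mulr2n mulrDl mul1r; congr (_ + _).
  by apply: eq_big_nat => a /andP[a0 _]; rewrite inner.
apply: eq_big_nat => a /andP[a0 _]; rewrite -inner//.
by apply: eq_bigr => b _; rewrite mulnC.
Qed.

Lemma sum_ln_ratio_sum_asymp x : 1 <= x ->
  `|summatory (fun a => ln_ratio_sum (x ^+ 2 / a%:R)) x
    - (x ^+ 2 * summatory (fun n => n%:R^-1) x
       - ((Num.truncn x)%:R * ln x + ln_ratio_sum x) / 2
       - (Num.truncn x)%:R * ln_sqrt2pi R)| <= 2.
Proof.
move=> x1; have x0 : 0 < x by apply: lt_le_trans x1.
have [_ Nx _ _] := truncn_ge1_bounds x1.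
rewrite -!summatory_cst -summatoryD -summatoryZr -summatoryZl -!summatoryB.
apply: le_trans (ler_norm_summatory _ _) _.
apply: (@le_trans _ _ (summatory (fun=> 2 / x) x)); last first.
  by rewrite summatory_cst mulrCA ger_pMr// ler_pdivrMr// mul1r.
apply: ler_summatory => a a0 ax; have a0' : 0 < a%:R :> R by rewrite ltr0n.
have /andP[xa1 _] := ge1_div_nat a0 ax; have x_le : x <= x ^+ 2 / a%:R.
  by rewrite expr2 -mulrA ler_peMr// ltW.
have -> : ln x + ln (x / a%:R) = ln (x ^+ 2 / a%:R).
  by rewrite -lnM ?posrE ?divr_gt0// expr2 mulrA.
apply: le_trans (ln_ratio_sum_asymp (le_trans x1 x_le)) _.
by rewrite ler_wpM2l// lef_pV2 ?posrE ?divr_gt0 ?exprn_gt0.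
Qed.

(* With [x = sqrt y] and [N] the integer part of [x], the sawtooth term of the
   harmonic sum cancels all terms that depend on [N]. *)
Lemma divisor_ln_sum_asymp : log_bounded 1 (fun y =>
  divisor_ln_sum y - (y * ln y + (2 * euler_gamma - 2) * y)).
Proof.
exists (`|ln_sqrt2pi R| + 20) => [|y y1]; first by rewrite addr_ge0.
have y0 : 0 < y by apply: lt_le_trans y1.
have [x x1 ->] : exists2 x : R, 1 <= x & y = x ^+ 2.
  by exists (Num.sqrt y); rewrite ?sqr_sqrtr ?(ltW y0)// -[leLHS]sqrtr1 ler_wsqrtr.
have x0 : 0 < x by apply: lt_le_trans x1.
have [_ Nx _ _] := truncn_ge1_bounds x1.
rewrite expr1 /log1 lnXn// divisor_ln_sum_hyperbola//.
have := sum_ln_ratio_sum_asymp x1; have := ln_ratio_sum_asymp x1.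
have := summatory_inv_asymp x1; have lnx := ln_ge0 x1.
set H := summatory _ x; set Q := ln_ratio_sum x; set S := summatory _ x.
set N := (Num.truncn x)%:R in Nx *; set L := ln x in lnx *; set c := ln_sqrt2pi R.
set H_err := H - _; set Q_err := Q - _; set S_err := S - _ => H_le Q_le S_le.
have -> : 2 * S - 2 * N * Q - (x ^+ 2 * (L *+ 2) + (2 * euler_gamma - 2) * x ^+ 2) =
    2 * S_err + 2 * (x ^+ 2 * H_err) - (1 + 2 * N) * Q_err + L / 2 + c.
  by rewrite /S_err /H_err /Q_err; field; rewrite gt_eqF.
have {}H_le : `|x ^+ 2 * H_err| <= 5.
  by rewrite normrM ger0_norm ?sqr_ge0// mulrC -ler_pdivlMr ?exprn_gt0.
have {}Q_le : `|(1 + 2 * N) * Q_err| <= 6.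
  have N1 : 0 <= 1 + 2 * N by rewrite addr_ge0// mulr_ge0.
  rewrite normrM ger0_norm//; apply: le_trans (ler_wpM2l N1 Q_le) _.
  by rewrite mulrA ler_pdivrMr//; lra.
have c_le : c <= `|c| /\ - c <= `|c| by rewrite ler_norm -normrN ler_norm.
have c0 : 0 <= `|c| * (L *+ 2) by rewrite mulr_ge0// mulrn_wge0.
move: H_le Q_le S_le; rewrite !ler_norml; lra.
Qed.

End DivisorLogSum.

(** * The sum of logarithms weighted by gcds *)

Section GcdLogSum.
Variable R : realType.
Implicit Types (f g : nat -> R) (x F T : R) (n q : nat).

Definition fact_excess n : R := ln n`!%:R - n%:R * ln n%:R + n%:R.

Lemma sum_gcdn_ln f n : (0 < n)%N ->
  \sum_(1 <= j < n.+1) dirichlet f arith_one (gcdn n j) * ln j%:R =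
  dirichlet f (arith_id R) n * (ln n%:R - 1) + dirichlet f fact_excess n.
Proof.
move=> n0; rewrite cesaro_sum_gcdn// /dirichlet mulr_suml -big_split/= !big_seq.
apply: eq_bigr => d; rewrite -dvdn_divisors// => dn; have d0 := dvdn_gt0 n0 dn.
have nd0 : (0 < n %/ d)%N by rewrite divn_gt0// dvdn_leq.
have -> : \sum_(1 <= m < (n %/ d).+1) ln (d * m)%:R =
    (n %/ d)%:R * ln d%:R + ln (n %/ d)`!%:R :> R.
  rewrite -sum_ln_nat.
  rewrite (@eq_big_nat _ _ _ _ _ _ (fun m => ln d%:R + ln m%:R)) => [|m /andP[m0 _]].
    by rewrite big_split/= sumr_const_nat subn1 mulr_natl.
  exact: arith_lnM.
have -> : ln n%:R = ln d%:R + ln (n %/ d)%:R :> R.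
  by rewrite -{1}(divnK dn) mulnC; exact: arith_lnM.
by rewrite /arith_id /fact_excess; ring.
Qed.

Lemma gcd_log_sum_decomp f g x : 1 <= x ->
  (forall n, (0 < n)%N -> g n = dirichlet (dirichlet f (arith_id R)) arith_one n) ->
  gcd_log_sum g x =
  summatory (fun n => f n / n%:R *
    (ln (x / expR 1) * summatory (arith_tau R) (x / n%:R)
     - divisor_ln_sum (x / n%:R))) x +
  summatory (fun n => dirichlet f fact_excess n / n%:R * (Num.truncn (x / n%:R))%:R) x.
Proof.
move=> x1 gE; have x0 : 0 < x by apply: lt_le_trans x1.
pose id2 := dirichlet (arith_id R) (arith_id R); pose fw := dirichlet f fact_excess.
transitivity (summatory (fun k => dirichlet f id2 k * ((ln k%:R - 1) / k%:R)) x
    + summatory (fun k => dirichlet fw (arith_id R) k * k%:R^-1) x).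
  rewrite -summatoryD; apply: eq_summatory => k k0 _.
  rewrite (@eq_big_nat _ _ _ _ _ _ (fun j =>
    dirichlet (dirichlet f (arith_id R)) arith_one (gcdn k j) * ln j%:R)) => [|j _].
    rewrite sum_gcdn_ln// /id2 dirichletA//.
    have -> : dirichlet fw (arith_id R) k =
        dirichlet (dirichlet f (arith_id R)) fact_excess k.
      by rewrite -!dirichletA//; apply: eq_dirichletr => // j; exact: dirichletC.
    ring.
  by rewrite gE// gcdn_gt0 k0.
rewrite (summatory_dirichlet f id2) ?(ltW x0)//.
rewrite (summatory_dirichlet fw _ (fun k => k%:R^-1)) ?(ltW x0)//.
congr (_ + _); apply: eq_summatory => n n0 _; have n0' : 0 < n%:R :> R by rewrite ltr0n.
  rewrite -[RHS]mulrA; congr (_ * _); rewrite -summatoryZl -summatoryB -summatoryZl.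
  apply: eq_summatory => m m0 _; have m0' : 0 < m%:R :> R by rewrite ltr0n.
  rewrite /id2 dirichlet_id_id// natrM lnM ?posrE//.
  rewrite !ln_div ?posrE ?divr_gt0 ?expR_gt0// expRK.
  by field; rewrite !gt_eqF.
rewrite -mulrA; congr (_ * _); rewrite [RHS]mulrC -summatory_cst.
apply: eq_summatory => m m0 _; rewrite /arith_id natrM.
by field; rewrite !pnatr_eq0 -!lt0n n0.
Qed.

Definition stirling_delta n : R := stirling_seq R n - ln_sqrt2pi R.

Lemma fact_excessE n :
  fact_excess n = 2^-1 * arith_ln R n + (ln_sqrt2pi R + stirling_delta n).
Proof. by rewrite /fact_excess /stirling_delta /stirling_seq /arith_ln; ring. Qed.

Lemma stirling_delta_gt0 n : (0 < n)%N -> 0 < stirling_delta n.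
Proof. by move=> /(stirling_bounds R)/andP[]. Qed.

Lemma stirling_delta_le1 n : (0 < n)%N -> stirling_delta n <= 1.
Proof.
move=> n0; have /andP[_ delta_le] := stirling_bounds R n0; apply: le_trans delta_le _.
by rewrite -[leRHS]mulr1 ler_pM ?invr_ge0 ?invf_le1 ?ltr0n ?ler1n.
Qed.

Lemma norm_stirling_delta_le1 n : (0 < n)%N -> `|stirling_delta n| <= 1.
Proof. by move=> n0; rewrite gtr0_norm ?stirling_delta_gt0 ?stirling_delta_le1. Qed.

Lemma dseries_stirling_delta s : 1 < s ->
  exists2 T : R, 0 < T & dseries s 0 stirling_delta T.
Proof.
move=> s1; have [n n0|T sT] := @dseries_exists R s 0 stirling_delta 1 s1.
  by rewrite mulr1 norm_stirling_delta_le1.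
exists T => //; apply: dseries_gt0 s1 _ _ sT => [n /stirling_delta_gt0/ltW//|].
exact: stirling_delta_gt0.
Qed.

Lemma dseries_fact_excess s T : 1 < s -> dseries s 0 stirling_delta T ->
  dseries s 1 fact_excess (ln_sqrt2pi R * zeta s - dzeta s / 2 + T).
Proof.
move=> s1 sT; have -> : ln_sqrt2pi R * zeta s - dzeta s / 2 + T =
  2^-1 * (- dzeta s) + (ln_sqrt2pi R * zeta s + T) by ring.
apply: (@eq_dseries _ _ _ (fun n => 2^-1 * arith_ln R n +
    (ln_sqrt2pi R * arith_one n + stirling_delta n))) => [n _|].
  by rewrite fact_excessE mulr1.
apply: dseriesD; first by apply: dseriesZ; exact: dseries_dzeta.
apply: dseriesW (_ : (0 <= 1)%N) _ => //; apply: dseriesD => //.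
by apply: dseriesZ; exact: dseries_zeta.
Qed.

(* The logarithmic part of [fact_excess] is kept convolved with [f], whose
   cancellation saves a logarithm. *)
Lemma harmonic_bound_dirichlet_fact_excess q f : harmonic_bound q f ->
  harmonic_bound q.+1 (dirichlet f (arith_ln R)) ->
  harmonic_bound q.+1 (dirichlet f fact_excess).
Proof.
move=> bf bfln; pose v n := ln_sqrt2pi R + stirling_delta n.
apply: (@harmonic_bound_le _ _ (fun n =>
    2^-1 * dirichlet f (arith_ln R) n + dirichlet f v n)) => [n n0|].
  have -> : dirichlet f fact_excess n =
      dirichlet f (fun k => 2^-1 * arith_ln R k + v k) n.
    by apply: eq_dirichletr => // k _; rewrite fact_excessE.
  by rewrite dirichletDr dirichletZr.
apply: harmonic_boundD; first exact: harmonic_boundZ.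
rewrite -addn1; apply: harmonic_bound_dirichlet bf _.
apply: (@harmonic_bound_bounded _ _ (`|ln_sqrt2pi R| + 1)) => n n0.
by apply: le_trans (ler_normD _ _) _; rewrite lerD2l norm_stirling_delta_le1.
Qed.

Lemma summatory_divisor_part_asymp q f F F' :
  harmonic_bound q.+1 f -> dseries 2 q f F ->
  dseries 2 q.+1 (fun n => f n * arith_ln R n) F' ->
  log_bounded q.+2 (fun x =>
    summatory (fun n => f n / n%:R *
      (ln (x / expR 1) * summatory (arith_tau R) (x / n%:R)
       - divisor_ln_sum (x / n%:R))) x -
    (F * x * ln x ^+ 2 + ((2 * euler_gamma - 3) * F - F') * x * ln x
     + (2 * F' - (4 * euler_gamma - 3) * F) * x
     + summatory (fun n => f n / n%:R * divisor_Delta (x / n%:R) * ln (x / expR 1)) x)).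
Proof.
move=> bf /dseries2P fF /dseries2P fF'.
pose A (l : R) := l * l + (2 * euler_gamma - 3) * l - (4 * euler_gamma - 3).
have A_bounded : log_bounded 2 (fun x => A (ln x)).
  have ln_bounded := @log_bounded_ln R.
  apply: log_boundedB; last exact: log_boundedW (log_bounded_cst _).
  apply: log_boundedD; first exact: (log_boundedM ln_bounded ln_bounded).
  by apply: log_boundedW (log_boundedZ _ ln_bounded).
have ln2_bounded : log_bounded 1 (fun x : R => ln x - 2).
  by apply: log_boundedB (@log_bounded_ln R) _; exact: log_boundedW (log_bounded_cst _).
have bP := log_bounded_weighted_sum bf (@divisor_ln_sum_asymp R).
rewrite addn1 in bP.
apply: eq_log_bounded (log_boundedB (log_boundedB (log_boundedM A_bounded fF)
  (log_boundedM ln2_bounded fF')) bP) => x x1.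
have x0 : 0 < x by apply: lt_le_trans x1.
have -> : ln (x / expR 1) = ln x - 1 by rewrite ln_div ?posrE ?expR_gt0// expRK.
set Sf := summatory (fun n => f n / n%:R ^+ 2) x.
set Sfln := summatory (fun n => f n * arith_ln R n / n%:R ^+ 2) x.
set SP := summatory (fun n => f n / n%:R * _) x.
set SD := summatory (fun n => f n / n%:R * _ * _) x; set S := summatory _ x.
suff -> : S = SD + (x * A (ln x) * Sf - x * (ln x - 2) * Sfln) - SP.
  by rewrite /A; ring.
rewrite /S /SD /Sf /Sfln /SP -!summatoryZl -summatoryB -summatoryD -summatoryB.
apply: eq_summatory => n n0 _; have n0' : 0 < n%:R :> R by rewrite ltr0n.
have -> : summatory (arith_tau R) (x / n%:R) = divisor_Delta (x / n%:R) +
    (x / n%:R * ln (x / n%:R) + (2 * euler_gamma - 1) * (x / n%:R)).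
  by rewrite /divisor_Delta subrK.
by rewrite /A /arith_ln ln_div ?posrE//; field; rewrite gt_eqF.
Qed.

Lemma gcd_log_sum_asymp q f g F F' T :
  (forall n, (0 < n)%N -> g n = dirichlet (dirichlet f (arith_id R)) arith_one n) ->
  harmonic_bound q.+1 f -> harmonic_bound q.+2 (dirichlet f (arith_ln R)) ->
  dseries 2 q f F -> dseries 2 q.+1 (fun n => f n * arith_ln R n) F' ->
  dseries 2 0 stirling_delta T ->
  log_bounded q.+2 (fun x => gcd_log_sum g x -
    (F * x * ln x ^+ 2 + ((2 * euler_gamma - 3) * F - F') * x * ln x
     + (2 * F' - (4 * euler_gamma - 3) * F
        + F * (ln_sqrt2pi R * zeta 2 - dzeta 2 / 2 + T)) * x
     + summatory (fun n => f n / n%:R * divisor_Delta (x / n%:R) * ln (x / expR 1)) x)).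
Proof.
move=> gE bf bfln fF fF' sT; have s1 : 1 < 2 :> R by rewrite ltr1n.
have bw := harmonic_bound_dirichlet_fact_excess bf bfln.
have sw : dseries 2 q.+2 (dirichlet f fact_excess)
    (F * (ln_sqrt2pi R * zeta 2 - dzeta 2 / 2 + T)).
  rewrite -(addn1 q.+1); apply: dseries_dirichlet bf fF (dseries_fact_excess s1 sT).
  by rewrite addn1 -addn2 leq_addr.
have := log_boundedD (summatory_divisor_part_asymp bf fF fF') (sum_truncn_asymp bw sw).
apply: eq_log_bounded => x x1; rewrite (gcd_log_sum_decomp x1 gE); ring.
Qed.

End GcdLogSum.

Lemma gcd_log_sum_moebius_pow (R : realType) q (g : nat -> R) T :
  (forall n, (0 < n)%N -> g n = dirichlet (dirichlet
     (dirichlet_pow (moebius R) q) (arith_id R)) arith_one n) ->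
  dseries 2 0 (stirling_delta R) T ->
  bigO_pinfty (fun x => gcd_log_sum g x -
    ((zeta 2 ^+ q.+1)^-1 * x * ln x ^+ 2
     + (zeta 2 ^+ q.+1)^-1
       * (2 * euler_gamma - 3 - q.+1%:R * (dzeta 2 / zeta 2)) * x * ln x
     - (zeta 2 ^+ q.+1)^-1
       * (4 * euler_gamma - 3 - (2 * q.+1)%:R * (dzeta 2 / zeta 2) + dzeta 2 / 2 - T
          - zeta 2 * ln (Num.sqrt (2 * pi))) * x
     + summatory (fun n => dirichlet_pow (moebius R) q n / n%:R
                           * divisor_Delta (x / n%:R) * ln (x / expR 1)) x))
   (fun x => ln x ^+ q.+2).
Proof.
move=> gE sT; have s1 : 1 < 2 :> R by rewrite ltr1n.
have z0 : zeta 2 != 0 :> R by rewrite gt_eqF ?zeta_gt0.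
apply: log_bounded_bigO_pinfty.
apply: eq_log_bounded (gcd_log_sum_asymp gE (harmonic_bound_moebius_pow R q)
  (harmonic_bound_moebius_pow_ln R q) (dseries_moebius_pow q s1)
  (dseries_moebius_pow_ln q s1) sT) => x _.
congr (_ - (_ + _)); rewrite !exprVn natrM -/(ln_sqrt2pi R) [_ ^+ q.+2]exprS.
by field; rewrite z0 expf_neq0.
Qed.

Theorem theorem4 (R : realType) :
  exists Theta : R, 0 < Theta /\
  bigO_pinfty
    (fun x : R => gcd_log_sum (@arith_id R) x -
      ((zeta 2)^-1 * x * ln x ^+ 2
       + (zeta 2)^-1 * (2 * euler_gamma - 3 - dzeta 2 / zeta 2)
         * x * ln x
       - (zeta 2)^-1 * (4 * euler_gamma - 3 - 2 * (dzeta 2 / zeta 2)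
                        + dzeta 2 / 2 - Theta * zeta 3
                        - zeta 2 * ln (Num.sqrt (2 * pi))) * x
       + summatory (fun n => moebius R n / n%:R * divisor_Delta (x / n%:R)
                             * ln (x / expR 1)) x))
    (fun x : R => ln x ^+ 2)
  /\
  bigO_pinfty
    (fun x : R => gcd_log_sum (@arith_phi R) x -
      ((zeta 2 ^+ 2)^-1 * x * ln x ^+ 2
       + (zeta 2 ^+ 2)^-1 * (2 * euler_gamma - 3
                             - 2 * (dzeta 2 / zeta 2)) * x * ln x
       - (zeta 2 ^+ 2)^-1 * (4 * euler_gamma - 3
                             - 4 * (dzeta 2 / zeta 2)
                             + dzeta 2 / 2 - Theta * zeta 3
                             - zeta 2 * ln (Num.sqrt (2 * pi))) * x
       + summatory (fun n => dirichlet (moebius R) (moebius R) n / n%:R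
                             * divisor_Delta (x / n%:R)
                             * ln (x / expR 1)) x))
    (fun x : R => ln x ^+ 3).
Proof.
have [|T T0 sT] := @dseries_stirling_delta R 2; first by rewrite ltr1n.
have z3 : 0 < zeta 3 :> R by rewrite zeta_gt0 ?ltr1n.
exists (T / zeta 3); split; first exact: divr_gt0.
rewrite divfK ?gt_eqF//; split.
  have := @gcd_log_sum_moebius_pow R 0 _ T (@arith_id_moebius R) sT.
  by rewrite expr1 mul1r.
exact: (@gcd_log_sum_moebius_pow R 1 _ T (@arith_phi_moebius R) sT).
Qed.
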